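(* Let $(X_n)$ be a countable (finite or countably infinite) family of Polish spaces and $X=\prod_n X_n$ with the product topology. For every $n$, let $\mathcal{P}_n$ be a non-empty convex $\sigma(ca^+_n,C_{b,n})$-compact set of Borel probability measures on $X_n$, and set $\phi_n(g):=\sup_{\nu_n\in\mathcal{P}_n}\langle g,\nu_n\rangle$. Let $\mathcal{P}$ be the set of all Borel probability measures $\mu$ on $X$ whose marginals $\mu\circ\pi_n^{-1}$ belong to $\mathcal{P}_n$ for all $n$. For $f\in B_b$ define $$\phi(f):=\inf\Big\{m+\sum_n\phi_n(g_n): m\in\mathbb{R},\ g_n\in B^+_{b,n}\text{ such that } m+\oplus g\ge f\Big\}.$$ Then $$\phi(f)=\max_{\mu\in\mathcal{P}}\langle f,\mu\rangle\quad\text{for all } f\in U_b.$$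
   Context: $B_b$ is the space of all bounded Borel measurable functions $f:X\to\mathbb{R}$ and $U_b$ the subset of bounded upper semicontinuous functions. $B^+_{b,n}$ is the set of all bounded Borel measurable functions $g:X_n\to\mathbb{R}_+=[0,\infty)$, $C_{b,n}$ the set of bounded continuous functions $X_n\to\mathbb{R}$, and $ca^+_n$ the set of finite (nonnegative) Borel measures on $X_n$; $\sigma(ca_n^+,C_{b,n})$ is the coarsest topology on $ca_n^+$ making all maps $\nu\mapsto\int g\,d\nu$, $g\in C_{b,n}$, continuous. $\langle f,\mu\rangle:=\int f\,d\mu$. For $g=(g_n)$, $\oplus g:=\sum_n g_n\circ\pi_n:X\to\mathbb{R}_+\cup\{+\infty\}$, where $\pi_n:X\to X_n$ is the $n$-th coordinate projection. Inequalities between functions are pointwise; $\sum_n\phi_n(g_n)$ takes values in $[0,+\infty]$. *)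

(* Defs.v *)
From HB Require Import structures.
From mathcomp Require Import all_boot all_order all_algebra.
From mathcomp Require Import all_classical all_reals all_analysis.

Set Implicit Arguments.
Unset Strict Implicit.
Unset Printing Implicit Defensive.

Import Order.TTheory GRing.Theory Num.Theory.
Import numFieldNormedType.Exports.

Local Open Scope classical_set_scope.
Local Open Scope ring_scope.

(* Completeness is only required of some metric inducing the given topology,
   so being Polish is a property of the topological space. *)
Definition polish (R : realType) (T : topologicalType) : Prop :=
  (exists2 D : set T, countable D & dense D) /\
  exists d : T -> T -> R,
    [/\ (forall x y, 0 <= d x y) /\ (forall x y, d x y = 0 <-> x = y),
        (forall x y, d x y = d y x),
        (forall x y z, d x z <= d x y + d y z),
        (forall (x : T) (A : set T), nbhs x A <->
          exists2 e : R, 0 < e & [set y | d x y < e] `<=` A) &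
        (forall u : nat -> T,
          (forall e : R, 0 < e -> exists N : nat, forall m n : nat,
            (N <= m)%N -> (N <= n)%N -> d (u m) (u n) < e) ->
          exists l : T, u @ \oo --> l)].

Definition borel (T : ptopologicalType) := g_sigma_algebraType (@open T).

HB.instance Definition _ (T : ptopologicalType) := Measurable.on (borel T).

Definition upper_semicontinuous (R : realType) (T : topologicalType)
    (f : T -> R) : Prop :=
  forall (x : T) (a : R), f x < a -> \forall y \near x, f y < a.

Definition Cb (R : realType) (T : topologicalType) : set (T -> R) :=
  [set g : T -> R | bounded_fun g /\ continuous g].

Definition Bb_plus (R : realType) (T : ptopologicalType) : set (T -> R) :=
  [set g : T -> R | [/\ bounded_fun g, (forall x, 0 <= g x) &
               measurable_fun [set: borel T] (g : borel T -> R)]].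

Definition Ub (R : realType) (T : topologicalType) : set (T -> R) :=
  [set f : T -> R | bounded_fun f /\ upper_semicontinuous f].

Definition ca_plus (R : realType) (T : ptopologicalType) : Type :=
  {finite_measure set (borel T) -> \bar R}.

HB.instance Definition _ (R : realType) (T : ptopologicalType) :=
  gen_eqMixin (ca_plus R T).
HB.instance Definition _ (R : realType) (T : ptopologicalType) :=
  gen_choiceMixin (ca_plus R T).

(* sigma(ca+, C_b): the coarsest topology making nu |-> <g, nu> continuous for
   every g in C_b, i.e. the supremum of the corresponding initial topologies. *)
Definition ca_plus_topology (R : realType) (T : ptopologicalType) : Type :=
  sup_topology (fun g : {g : T -> R | @Cb R T g} =>
    Topological.class (initial_topology
      (fun nu : ca_plus R T => \int[nu]_(x in [set: borel T]) sval g x))).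

HB.instance Definition _ (R : realType) (T : ptopologicalType) :=
  Topological.copy (ca_plus R T) (ca_plus_topology R T).

(* A library measure is a function on all subsets, its values on non-measurable
   sets being irrelevant. Whether a measure belongs to a set of measures is
   therefore always understood up to equality on the Borel sets, both in
   [convex_measures] and in [couplings]. *)
Definition convex_measures (R : realType) (T : ptopologicalType)
    (P : set (ca_plus R T)) : Prop :=
  forall (mu nu : ca_plus R T) (t : R), P mu -> P nu -> 0 <= t <= 1 ->
    exists2 rho : ca_plus R T, P rho &
      forall A : set (borel T), measurable A ->
        (rho A = t%:E * mu A + (1 - t)%:E * nu A)%E.

Definition phi_marginal (R : realType) (T : ptopologicalType)
    (P : set (ca_plus R T)) (g : T -> R) : \bar R :=
  ereal_sup [set (\int[nu]_(x in [set: borel T]) (g x)%:E)%E | nu in P].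

HB.instance Definition _ (I : Type) (X : I -> ptopologicalType) :=
  isPointed.Build (prod_topology X) (fun n => point).

Definition oplus (R : realType) (I : countType) (X : I -> ptopologicalType)
    (g : forall n, X n -> R) (x : prod_topology X) : \bar R :=
  (\esum_(n in [set: I]) (g n (x n))%:E)%E.

Definition phi (R : realType) (I : countType) (X : I -> ptopologicalType)
    (P : forall n, set (ca_plus R (X n))) (f : prod_topology X -> R) : \bar R :=
  ereal_inf [set r : \bar R | exists (m : R) (g : forall n, X n -> R),
    [/\ forall n, @Bb_plus R (X n) (g n),
        forall x, ((f x)%:E <= m%:E + oplus g x)%E &
        r = (m%:E + \esum_(n in [set: I]) phi_marginal (P n) (g n))%E]].

Definition couplings (R : realType) (I : countType)
    (X : I -> ptopologicalType) (P : forall n, set (ca_plus R (X n))) :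
    set (probability (borel (prod_topology X)) R) :=
  [set mu | forall n, exists2 nu : ca_plus R (X n), P n nu &
    forall A : set (borel (X n)), measurable A ->
      pushforward mu
        (fun x : borel (prod_topology X) => x n : borel (X n)) A = nu A].

(* Main.v *)
From HB Require Import structures.
Require Import Defs.
From mathcomp Require Import all_boot all_order all_algebra.
From mathcomp Require Import all_classical all_reals all_analysis.
From mathcomp Require Import measurable_realfun ring lra.

Import Order.TTheory GRing.Theory Num.Theory.
Import numFieldNormedType.Exports.
Local Open Scope classical_set_scope.
Local Open Scope ring_scope.

(** Integrating a hedge [m + oplus g >= f] against a coupling shows that every
coupling gives [f] an integral at most [phi P f] ([weak_duality]).

For the converse, [phi P] is finite and sublinear on the bounded functions
([rphi_sublinear]), so Hahn-Banach gives a linear functional [L <= phi P] on all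
bounded functions with [L f = phi P f]. It is positive and normalized, because
[phi P h <= sup h]. It remains to find a coupling [mu] with
[L f <= \int f d mu] ([exists_coupling_above_functional]); as [L] may fail to be
sigma-additive, [mu] cannot simply represent [L].

- Marginals. On continuous functions of the [n]-th coordinate, [L] is below the
  support function of the compact convex set [P n], hence is the integral
  against some [nu n] in [P n] ([exists_marginal]).

- Tightness. Let [m A] be the value of [L] at the indicator of [A], for every
  subset [A] of the product. It is finitely additive, and on closed cylinders it
  is at most [nu n]. As each factor is Polish, [nu n] lives, up to a small
  error, on finitely many small balls; an ultrafilter argument then shows that
  [m] tends to zero along closed sets that decrease to the empty set
  ([charge_closed_vanish]).

- The measure. The outer measure [outer_charge] is the infimum of the numbers
  [sup_N m (G N)] over the increasing open covers [G]. By tightness it is at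
  least [m] on closed sets; on open cylinders it is at most [nu n]. The second
  bound makes cylinders measurable in the sense of Caratheodory, and on a
  countable product of second countable spaces these generate the Borel sets.
  The resulting measure [mu] has the marginals [nu n].

- Comparison. The superlevel sets of the upper semicontinuous [f] are closed, so
  [mu] gives them at least the mass that [m] does, and summing over thin layers
  of [f] yields [L f <= \int f d mu] ([functional_le_integral]). *)

Set Implicit Arguments.
Unset Strict Implicit.
Unset Printing Implicit Defensive.

(** * The Hahn-Banach theorem *)

Section HahnBanach.
Context {R : realType} {V : lmodType R}.

(** Functionals are total functions on [V] of which only the values on the
    subspace [W] matter; this spares a type of bounded functions. *)
Definition sublinear (W : set V) (q : V -> R) :=
  (forall u v, W u -> W v -> q (u + v) <= q u + q v) /\
  (forall t u, 0 < t -> W u -> q (t *: u) <= t * q u).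

Definition linear_on (W : set V) (L : V -> R) :=
  (forall u v, W u -> W v -> L (u + v) = L u + L v) /\
  (forall t u, W u -> L (t *: u) = t * L u).

Variable W : set V.
Hypothesis W0 : W 0.
Hypothesis WD : forall u v, W u -> W v -> W (u + v).
Hypothesis WZ : forall t u, W u -> W (t *: u).

Lemma sublinear0 q : sublinear W q -> q 0 = 0.
Proof.
move=> [_ qZ]; apply/eqP; rewrite eq_le.
have h2 := qZ 2 0 (ltr0n _ 2) W0; rewrite scaler0 in h2.
have h3 : 0 < (2^-1 : R) by rewrite invr_gt0.
have := qZ _ 0 h3 W0; rewrite scaler0; lra.
Qed.

Lemma sublinearZ q t u : sublinear W q -> 0 <= t -> W u ->
  q (t *: u) = t * q u.
Proof.
move=> sq; rewrite le_eqVlt => /predU1P[<- _|t0 Wu].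
  by rewrite scale0r mul0r sublinear0.
apply/eqP; rewrite eq_le sq.2 //=.
have ti : 0 < t^-1 by rewrite invr_gt0.
have := sq.2 _ _ ti (WZ t Wu); rewrite scalerA mulVf ?gt_eqF // scale1r.
by rewrite ler_pdivlMl.
Qed.

Lemma sublinearN q u : sublinear W q -> W u -> - q (- u) <= q u.
Proof.
move=> sq Wu; have := sq.1 u (- u) Wu.
rewrite -scaleN1r => /(_ (WZ _ Wu)).
rewrite scaleN1r subrr (sublinear0 sq); lra.
Qed.

(** The largest sublinear minorant of [q] whose value at [- x] is at most
    [- q x]. A minimal sublinear functional is its own tilt in every direction
    [x], and this gives [q u + q x <= q (u + x)], hence linearity. *)
Definition tilt (q : V -> R) (x : V) (u : V) : R :=
  inf [set q (u + t *: x) - t * q x | t in [set t : R | 0 <= t]].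

Lemma tilt_lb q x u : sublinear W q -> W x -> W u ->
  lbound [set q (u + t *: x) - t * q x | t in [set t : R | 0 <= t]] (- q (- u)).
Proof.
move=> sq Wx Wu _ [t /= t0 <-].
rewrite -(sublinearZ sq t0 Wx).
have WNu : W (- u) by rewrite -scaleN1r; exact: WZ.
have := sq.1 (u + t *: x) (- u) (WD Wu (WZ t Wx)) WNu.
by rewrite addrAC subrr add0r; lra.
Qed.

Lemma tilt_le q x u t : sublinear W q -> W x -> W u -> 0 <= t ->
  tilt q x u <= q (u + t *: x) - t * q x.
Proof.
move=> sq Wx Wu t0; apply: ge_inf; last by exists t.
by exists (- q (- u)); exact: tilt_lb.
Qed.

Lemma le_tilt q x u a :
  (forall t, 0 <= t -> a <= q (u + t *: x) - t * q x) -> a <= tilt q x u.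
Proof.
move=> h; apply: lb_le_inf; last by move=> _ [t /= t0 <-]; exact: h.
by eexists; exists 0 => /=.
Qed.

Lemma tilt_sublinear q x : sublinear W q -> W x -> sublinear W (tilt q x).
Proof.
move=> sq Wx; split=> [u v Wu Wv|s u s0 Wu].
  rewrite -lerBlDl; apply: le_tilt => t t0.
  rewrite lerBlDl -lerBlDr; apply: le_tilt => s s0.
  have := tilt_le sq Wx (WD Wu Wv) (addr_ge0 s0 t0).
  have := sq.1 _ _ (WD Wu (WZ s Wx)) (WD Wv (WZ t Wx)).
  by rewrite scalerDl addrACA; lra.
rewrite -ler_pdivrMl //; apply: le_tilt => t t0.
rewrite ler_pdivrMl //.
have := tilt_le sq Wx (WZ s Wu) (mulr_ge0 (ltW s0) t0).
by rewrite -scalerA -scalerDr (sublinearZ sq (ltW s0) (WD Wu (WZ t Wx))); lra.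
Qed.

Lemma tilt_le_id q x u : sublinear W q -> W x -> W u -> tilt q x u <= q u.
Proof.
move=> sq Wx Wu; apply: le_trans (tilt_le sq Wx Wu (lexx 0)) _.
by rewrite scale0r mul0r addr0 subr0.
Qed.

(** Zorn's lemma: the pointwise infimum of a chain is again sublinear, because
    of any two members of a chain one lies below the other; it is finite because
    every sublinear [q <= p] satisfies [- p (- u) <= q u]. *)
Lemma minimal_sublinear p : sublinear W p -> exists q, [/\ sublinear W q,
  forall u, W u -> q u <= p u &
  forall q', sublinear W q' -> (forall u, W u -> q' u <= q u) ->
    forall u, W u -> q u <= q' u].
Proof.
move=> sp.
pose T := {q : V -> R | sublinear W q /\ forall u, W u -> q u <= p u}.
pose p0 : T := exist _ p (conj sp (fun u _ => lexx (p u))).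
pose Rr : rel T := fun q q' => `[< forall u, W u -> sval q' u <= sval q u >].
have Tlb (q : T) u : W u -> - p (- u) <= sval q u.
  case: q => q [sq qp] /= Wu; apply: le_trans (sublinearN sq Wu).
  by rewrite lerN2 qp // -scaleN1r; exact: WZ.
have [||A totA|[q [sq qp]] qmin] := @ZL_preorder T p0 Rr.
- by move=> t; apply/asboolP.
- move=> r s t /asboolP h1 /asboolP h2; apply/asboolP => u Wu.
  exact: le_trans (h2 _ Wu) (h1 _ Wu).
- have [[a0 Aa0]|A0] := pselect (A !=set0); last first.
    by exists p0 => s As; exfalso; apply: A0; exists s.
  pose q u := inf [set sval a u | a in A].
  have qle a u : A a -> W u -> q u <= sval a u.
    move=> Aa Wu; apply: ge_inf; last by exists a.
    by exists (- p (- u)) => _ [b Ab <-]; exact: Tlb.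
  have leq c u : (forall a, A a -> c <= sval a u) -> c <= q u.
    move=> h; apply: lb_le_inf; first by exists (sval a0 u); exists a0.
    by move=> _ [b Ab <-]; exact: h.
  have sq : sublinear W q.
    split=> [u v Wu Wv|t u t0 Wu].
      rewrite -lerBlDl; apply: (leq) => a Aa; rewrite lerBlDl -lerBlDr.
      apply: (leq) => b Ab; rewrite lerBlDr.
      have [/asboolP ab|/asboolP ba] := totA _ _ Aa Ab.
        apply: le_trans (qle _ _ Ab (WD Wu Wv)) _.
        apply: le_trans ((svalP b).1.1 u v Wu Wv) _.
        by rewrite lerD2l ab.
      apply: le_trans (qle _ _ Aa (WD Wu Wv)) _.
      apply: le_trans ((svalP a).1.1 u v Wu Wv) _.
      by rewrite lerD2r ba.
    rewrite -ler_pdivrMl //; apply: (leq) => a Aa; rewrite ler_pdivrMl //.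
    exact: le_trans (qle _ _ Aa (WZ t Wu)) ((svalP a).1.2 _ _ t0 Wu).
  have qp u : W u -> q u <= p u.
    by move=> Wu; apply: le_trans (qle _ _ Aa0 Wu) ((svalP a0).2 _ Wu).
  exists (exist _ q (conj sq qp)) => a Aa; apply/asboolP => u Wu /=.
  exact: qle.
exists q; split=> // q' sq' q'q.
have q'p u : W u -> q' u <= p u.
  by move=> Wu; exact: le_trans (q'q _ Wu) (qp _ Wu).
have := qmin (exist _ q' (conj sq' q'p)).
by move=> h; have /asboolP := h (asboolT q'q).
Qed.

(** A minimal sublinear minorant is linear. Minimizing below [tilt p v] instead
    of [p] forces [L (- v) <= - p v], so that [L] touches [p] at [v]. *)
Lemma hahn_banach p v : sublinear W p -> W v -> exists L, [/\ linear_on W L,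
  forall u, W u -> L u <= p u & L v = p v].
Proof.
move=> sp Wv; have sp' := tilt_sublinear sp Wv.
have [L [sL Lp' Lmin]] := minimal_sublinear sp'.
have Lp u : W u -> L u <= p u.
  by move=> Wu; exact: le_trans (Lp' _ Wu) (tilt_le_id sp Wv Wu).
have LD u w : W u -> W w -> L (u + w) = L u + L w.
  move=> Wu Ww; apply/eqP; rewrite eq_le sL.1 //=.
  have := Lmin _ (tilt_sublinear sL Ww) (fun u => @tilt_le_id L w u sL Ww) u Wu.
  move=> /le_trans /(_ (tilt_le sL Ww Wu ler01)).
  by rewrite scale1r mul1r; lra.
have WN u : W u -> W (- u) by rewrite -scaleN1r; exact: WZ.
have LN u : W u -> L (- u) = - L u.
  move=> Wu; have := LD _ _ Wu (WN _ Wu).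
  by rewrite subrr (sublinear0 sL); lra.
exists L; split=> //.
  split=> // t u Wu; have [t0|t0] := leP 0 t; first exact: sublinearZ.
  have nt : 0 <= - t by rewrite oppr_ge0 ltW.
  rewrite -[t in LHS]opprK scaleNr LN; last exact: WZ.
  by rewrite (sublinearZ sL nt Wu) mulNr opprK.
apply/eqP; rewrite eq_le Lp //=.
have := le_trans (Lp' _ (WN _ Wv)) (tilt_le sp Wv (WN _ Wv) ler01).
by rewrite scale1r mul1r addNr (sublinear0 sp) LN //; lra.
Qed.

Lemma linear_on_sum L (s : seq V) (w : V -> R) : linear_on W L ->
  (forall v, v \in s -> W v) ->
  W (\sum_(v <- s) w v *: v) /\
  L (\sum_(v <- s) w v *: v) = \sum_(v <- s) w v * L v.
Proof.
move=> [LD LZ]; elim: s => [|v s IH] Ws.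
  by rewrite !big_nil; split=> //; rewrite -(scale0r 0) LZ // mul0r.
have [Wsum Lsum] := IH (fun u us => Ws u (@mem_behead _ (v :: s) u us)).
have Wv : W v by apply: Ws; rewrite mem_head.
rewrite !big_cons; split; first by apply: WD => //; exact: WZ.
by rewrite LD ?LZ ?Lsum //; exact: WZ.
Qed.

End HahnBanach.

(** * Closed sets and finite measures on a Polish space *)

Section Measures.
Context {R : realType}.

(** Continuity from above along the sets where [u < 1/(k+1)]: estimates proved
    for the open neighbourhoods [u < a] of a zero set pass to the zero set
    itself, and estimates on annuli [0 < u < a] pass to the empty set. *)
Lemma measure_inf_level d (T : measurableType d)
    (mu : {finite_measure set T -> \bar R}) (u : T -> R) (A : set T) c :
  measurable A -> (forall a, measurable [set x | u x < a]) ->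
  (forall a, 0 < a -> (c <= mu (A `&` [set x | (u x < a)%R]))%E) ->
  (c <= mu (A `&` [set x | (u x <= 0)%R]))%E.
Proof.
move=> mA mu_ h.
pose F k := A `&` [set x | u x < k.+1%:R^-1].
have mF k : measurable (F k) by apply: measurableI.
have FE : \bigcap_k F k = A `&` [set x | u x <= 0].
  apply/seteqP; split=> x /=.
    move=> Fx; split; first exact: (Fx 0%N I).1.
    rewrite leNgt; apply/negP => u0.
    have [k _ /(_ k (leqnn k))] := near_infty_natSinv_lt (PosNum u0).
    by move=> /lt_trans /(_ (Fx k I).2) /=; rewrite ltxx.
  move=> [Ax ux] k _; split=> //=; apply: le_lt_trans ux _.
  by rewrite invr_gt0.
have cv : mu \o F @ \oo --> mu (A `&` [set x | (u x <= 0)%R]).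
  rewrite -FE; apply: nonincreasing_cvg_mu => //.
  - by rewrite -ge0_fin_numE //; exact: fin_num_measure.
  - exact: bigcap_measurable.
  - move=> m n mn; apply/subsetPset => x [Ax /= ux]; split => //=.
    apply: lt_le_trans ux _; rewrite lef_pV2 ?posrE // ler_nat //.
rewrite -(cvg_lim _ cv) //; apply: lime_ge.
  by apply/cvg_ex; eexists; exact: cv.
by apply: nearW => k; apply: h; rewrite invr_gt0.
Qed.

End Measures.

Section PolishSpace.
Context {R : realType} {T : ptopologicalType}.
Hypothesis T_polish : polish R T.

Lemma open_borel (U : set T) : open U -> measurable (U : set (borel T)).
Proof. exact: sub_sigma_algebra. Qed.

Lemma closed_borel (F : set T) : closed F -> measurable (F : set (borel T)).
Proof.
by move=> cF; rewrite -[F]setCK; apply: measurableC; apply: open_borel;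
  exact: closed_openC.
Qed.

Lemma open_lt (u : T -> R) a : continuous u -> open [set x | u x < a].
Proof. by move=> cu; apply: (open_comp _ (@open_lt _ a)) => x _; exact: cu. Qed.

Lemma open_gt (u : T -> R) a : continuous u -> open [set x | a < u x].
Proof. by move=> cu; apply: (open_comp _ (@open_gt _ a)) => x _; exact: cu. Qed.

Lemma closed_le (u : T -> R) a : continuous u -> closed [set x | u x <= a].
Proof.
by move=> cu; apply: (closed_comp _ (@closed_le _ a)) => x _; exact: cu.
Qed.

Lemma closed_ge (u : T -> R) a : continuous u -> closed [set x | a <= u x].
Proof.
by move=> cu; apply: (closed_comp _ (@closed_ge _ a)) => x _; exact: cu.
Qed.

(** The witness is the distance to [F], cut at [1]; the constant [1] in the
    infimum also covers the empty set. Every later use of the metric to separate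
    sets goes through this function. *)
Lemma zero_set_closed (F : set T) : closed F -> exists u : T -> R,
  [/\ continuous u, forall x, 0 <= u x <= 1 & F = [set x | u x <= 0]].
Proof.
move=> cF; have [_ [d [[d0 dE] dC dD dN _]]] := T_polish.
pose S x := 1 |` [set d x y | y in F].
pose u x := inf (S x).
have S0 x : lbound (S x) 0.
  by move=> _ [->|[y _ <-]] => //; exact: d0.
have u1 x : u x <= 1 by apply: ge_inf; [exists 0|left].
have ud x y : F y -> u x <= d x y.
  by move=> Fy; apply: ge_inf; [exists 0|right; exists y].
have leu x c : c <= 1 -> (forall y, F y -> c <= d x y) -> c <= u x.
  move=> c1 cy; apply: lb_le_inf; first by exists 1; left.
  by move=> _ [->|[y Fy <-]]; [|exact: cy].
have u0 x : 0 <= u x by apply: (leu).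
have uL x y : u x - d x y <= u y.
  apply: (leu); first by rewrite lerBlDr (le_trans (u1 x)) // lerDl.
  move=> z Fz; rewrite lerBlDl; apply: le_trans (ud _ _ Fz) (dD _ _ _).
exists u; split=> [x|x|].
- apply/cvgrPdist_lt => e e0; apply/dN; exists e => // y /= dxy.
  have := uL x y; have := uL y x; rewrite (dC y x) ltr_norml; lra.
- by rewrite u0 u1.
- apply/seteqP; split=> x /=.
    by move=> Fx; have := ud x x Fx; rewrite (dE x x).2.
  move=> ux; apply: contrapT => nFx.
  have : nbhs x (~` F).
    by apply: open_nbhs_nbhs; split=> //; exact: closed_openC.
  move=> /dN[e e0 eF].
  have : Num.min 1 e <= u x.
    apply: (leu); first by rewrite ge_min lexx.
    move=> y Fy; rewrite ge_min; apply/orP; right.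
    by rewrite leNgt; apply/negP => /eF.
  by move=> /le_trans/(_ ux); rewrite ge_min; lra.
Qed.

End PolishSpace.

(** * Tightness *)

Section Tightness.
Context {R : realType}.

Lemma open_dist_ball (T : topologicalType) (d : T -> T -> R) :
  (forall x y z, d x z <= d x y + d y z) ->
  (forall x A, nbhs x A <->
    exists2 e : R, 0 < e & [set y | d x y < e] `<=` A) ->
  forall p s, open [set y | d p y < s].
Proof.
move=> dtri dN p s; rewrite openE => y /= py; apply/dN; exists (s - d p y).
  by rewrite subr_gt0.
by move=> z /= yz; have := dtri p y z; lra.
Qed.

Lemma dense_sequence (T : ptopologicalType) (D : set T) :
  countable D -> dense D ->
  exists x : nat -> T, forall U, open U -> U !=set0 -> exists i, U (x i).
Proof.
move=> cD dD; have [g ginj] := countable_injP D cD.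
exists (fun i => xget point [set p | D p /\ g p = i]) => U oU U0.
have [p [Up Dp]] := dD U U0 oU; exists (g p).
case: xgetP => [q _ [Dq gq]|/(_ p)]; last by case.
by have -> : q = p by apply: ginj; rewrite ?inE.
Qed.

Lemma polish_base (T : ptopologicalType) : polish R T ->
  exists B : nat -> set T, (forall k, open (B k)) /\
    forall x A, nbhs x A -> exists k, B k x /\ B k `<=` A.
Proof.
move=> [[D cD dD] [d [[d0 dE] dC dtri dN _]]].
have dxx x : d x x = 0 by rewrite (dE x x).2.
have [x xD] := dense_sequence cD dD.
have oball := open_dist_ball dtri dN.
pose B (k : nat) : set T :=
  if @unpickle (nat * nat)%type k is Some (i, j) then
    [set y | d (x i) y < j.+1%:R^-1] else set0.
exists B; split=> [k|y A /dN[e e0 eA]].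
  by rewrite /B; case: unpickle => [[i j]|]; [exact: oball|exact: open0].
have e2 : 0 < e / 2 by lra.
have [j _ /(_ j (leqnn j)) /= je] := near_infty_natSinv_lt (PosNum e2).
have j0 : 0 < j.+1%:R^-1 :> R by rewrite invr_gt0.
have [||i /= yi] := xD [set z | d y z < j.+1%:R^-1]; first exact: oball.
  by exists y => /=; rewrite dxx.
exists (pickle (i, j)); rewrite /B pickleK /=; split; first by rewrite dC.
move=> z /= iz; apply: eA => /=; apply: le_lt_trans (dtri y (x i) z) _.
have {}je : j.+1%:R^-1 < e / 2 := je.
by move: yi iz je; move: (d _ _) (d _ _) (_^-1) => a b c; lra.
Qed.

(** [C k] is a finite union of balls of radius [1/(k+1)] carrying all but [e k]
    of the mass. An ultrafilter that contains every [C k] contains for each [k]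
    a single ball, hence is Cauchy and converges by completeness. This replaces
    the compact set of Ulam's theorem by what compactness is used for, in a form
    that can be tested one [k] at a time. The filter is not asked to be an
    [UltraFilter] so that the image of an ultrafilter qualifies at once. *)
Lemma polish_tight (T : ptopologicalType) (nu : ca_plus R T) (e : nat -> R) :
  polish R T -> (forall k, 0 < e k) -> exists C : nat -> set T,
  [/\ forall k, open (C k), forall k, (nu (~` C k) <= (e k)%:E)%E &
      forall U : set_system T, ProperFilter U ->
        (forall A, U A \/ U (~` A)) -> (forall k, U (C k)) ->
        exists l : T, U --> l].
Proof.
move=> [[D cD dD] [d [[d0 dE] dC dtri dN dcomplete]]] e0.
have dxx x : d x x = 0 by rewrite (dE x x).2.
have [x xD] := dense_sequence cD dD.
pose r k : R := k.+1%:R^-1.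
have r0 k : 0 < r k by rewrite invr_gt0.
have oball := open_dist_ball dtri dN.
(* the complement of the first [N] balls of radius [r k] *)
pose A k N := [set y | forall i, (i < N)%N -> r k <= d (x i) y].
have cA k N : closed (A k N).
  have -> : A k N = \bigcap_(i in `I_N) ~` [set y | d (x i) y < r k].
    apply/seteqP; split=> y /= h i iN; first by apply/negP; rewrite -leNgt h.
    by rewrite leNgt; apply/negP; exact: h.
  by apply: closed_bigI => i _; apply: open_closedC.
have mA k N : measurable (A k N : set (borel T)) by exact: closed_borel.
have A0 k : \bigcap_N A k N = set0.
  apply/seteqP; split=> // y Ay.
  have [||i /= yi] := xD [set z | d y z < r k]; first exact: oball.
    by exists y => /=; rewrite dxx.
  by have := Ay i.+1 Logic.I i (leqnn _); rewrite dC leNgt => /negP; apply.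
have /choice[N hN] : forall k, exists N, (nu (A k N) <= (e k)%:E)%E.
  move=> k.
  have cv : nu \o A k @ \oo --> nu (\bigcap_N A k N).
    apply: nonincreasing_cvg_mu => //.
    - by rewrite -ge0_fin_numE //; exact: fin_num_measure.
    - by rewrite A0.
    - move=> i j ij; apply/subsetPset => y /= h k' k'i; apply: h.
      exact: leq_trans k'i ij.
  rewrite A0 measure0 in cv.
  have : \forall N \near \oo, (nu (A k N) < (e k)%:E)%E.
    apply: (cv [set y | (y < (e k)%:E)%E]); apply: open_ereal_lt'.
    by rewrite lte_fin.
  by move=> [N _ hN]; exists N; apply/ltW/(hN N) => /=.
exists (fun k => ~` A k (N k)); split.
- by move=> k; apply: closed_openC.
- by move=> k; rewrite setCK.
move=> U FU UU UC.
have /choice[c hc] : forall k, exists c, U [set y | d c y < r k].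
  move=> k.
  have [[i Ui]|nU] := pselect (exists i, U [set y | d (x i) y < r k]).
    by exists (x i).
  exfalso.
  have UA M : U (A k M).
    elim: M => [|M IH]; first by apply: filterE.
    have : U (A k M `&` ~` [set y | d (x M) y < r k]).
      apply: filterI => //.
      by have [Ub|//] := UU [set y | d (x M) y < r k]; case: nU; exists M.
    apply: filterS => y [Ay /= /negP]; rewrite -leNgt => yM i.
    by rewrite ltnS leq_eqVlt => /predU1P[->//|]; exact: Ay.
  by have [y [Ay]] := filter_ex (filterI (UA (N k)) (UC k)); apply.
have dcc k l : d (c k) (c l) < r k + r l.
  have [y [/= h1 h2]] := filter_ex (filterI (hc k) (hc l)).
  by have := dtri (c k) y (c l); rewrite (dC y (c l)); lra.
have rlt (a : R) : 0 < a -> exists M, forall k, (M <= k)%N -> r k < a.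
  move=> a0; have [M _ hM] := near_infty_natSinv_lt (PosNum a0).
  by exists M => k Mk; apply: (hM k).
have [l cl] : exists l : T, c @ \oo --> l.
  apply: dcomplete => a a0; have a2 : 0 < a / 2 by lra.
  have [M hM] := rlt _ a2; exists M => k n Mk Mn.
  by have := dcc k n; have := hM _ Mk; have := hM _ Mn; lra.
exists l => B /dN[a a0 aB].
have a2 : 0 < a / 2 by lra.
have [M hM] := rlt _ a2.
have [M' _ hM'] : \forall k \near \oo, d l (c k) < a / 2.
  by apply: (cl [set y | d l y < a / 2]); apply/dN; exists (a / 2).
pose k := maxn M M'.
apply: filterS (hc k) => y /= cy; apply: aB => /=.
have := hM k (leq_maxl _ _); have := hM' k (leq_maxr _ _) => /=.
by have := dtri l (c k) y; lra.
Qed.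

Lemma prod_topology_cvg (I : Type) (X : I -> topologicalType)
    (F : set_system (prod_topology X)) (l : prod_topology X) : Filter F ->
  (forall n, (fun x : prod_topology X => x n) @ F --> l n) -> F --> l.
Proof.
move=> FF Fl; apply/cvg_sup => n U [V] [[W] oW <-] WfN WU.
by apply: filterS WU _; apply: (Fl n); apply: open_nbhs_nbhs.
Qed.

End Tightness.

(** * From a finitely additive set function to a coupling *)

(** Here [m] is defined and additive on all subsets of the product; [m_nu] is
    its link with the sigma-additive measures [nu]. *)
Section Charge.
Context {R : realType} {I : countType} {X : I -> ptopologicalType}.
Notation XX := (prod_topology X).
Hypothesis X_polish : forall n, polish R (X n).
Variable nu : forall n, ca_plus R (X n).
Variable m : set XX -> R.
Hypothesis m_ge0 : forall A, 0 <= m A.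
Hypothesis mU : forall A B, A `&` B = set0 -> m (A `|` B) = m A + m B.
Hypothesis mT : m setT = 1.
Notation pr n := (fun x : XX => x n).
Hypothesis m_nu : forall n (F : set (X n)), closed F ->
  ((m (pr n @^-1` F))%:E <= nu n F)%E.

Lemma pr_continuous n : continuous (pr n).
Proof. exact: (@proj_continuous I X n). Qed.

Lemma charge0 : m set0 = 0.
Proof.
have := mU (setI0 (@set0 XX)); rewrite setU0; lra.
Qed.

Lemma chargeID A B : m A = m (A `&` B) + m (A `\` B).
Proof.
rewrite -mU ?setUIDK //.
by apply/seteqP; split=> // x /= [[_ Bx] [_]].
Qed.

Lemma le_charge A B : A `<=` B -> m A <= m B.
Proof.
by move=> /setIidPr AB; rewrite (chargeID B A) AB lerDl.
Qed.

Lemma charge_le1 A : m A <= 1.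
Proof. by rewrite -mT; exact: le_charge. Qed.

Lemma chargeU_le A B : m (A `|` B) <= m A + m B.
Proof.
rewrite (chargeID _ A) setUK lerD2l; apply: le_charge.
by move=> x [[]].
Qed.

(** If [m (F N)] stayed above [e], then removing from [F N] the complements of
    the tight sets of all coordinates, whose masses add up to at most [e], would
    leave nonempty sets. An ultrafilter on points chosen there converges in
    every coordinate, and its limit lies in every [F N]. *)
Lemma charge_closed_vanish (F : nat -> set XX) (e : R) :
  (forall N, closed (F N)) -> (forall M N, (M <= N)%N -> F N `<=` F M) ->
  \bigcap_N F N = set0 -> 0 < e -> exists N, m (F N) <= e.
Proof.
move=> cF dF F0 e0; apply: contrapT => /forallNP nF.
(* the budget [e] is shared between all pairs of a coordinate and an index *)
pose eps (n : I) (k : nat) : R := e / 2 ^+ (pickle (n, k)).+1.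
have eps0 n k : 0 < eps n k by rewrite divr_gt0 // exprn_gt0.
pose Cn n := cid (polish_tight (nu n) (X_polish n) (eps0 n)).
pose C n := sval (Cn n).
have oC n k : open (C n k) by have [h _ _] := svalP (Cn n); exact: h.
have nuC n k : (nu n (~` C n k) <= (eps n k)%:E)%E.
  by have [_ h _] := svalP (Cn n); exact: h.
have ultC n (U : set_system (X n)) : ProperFilter U ->
    (forall A, U A \/ U (~` A)) -> (forall k, U (C n k)) ->
    exists l : X n, U --> l.
  by have [_ _ h] := svalP (Cn n); exact: h.
pose D (j : nat) : set XX :=
  if @pickle_inv (I * nat)%type j is Some (n, k) then pr n @^-1` C n k
  else setT.
have mD j : m (~` D j) <= e / 2 ^+ j.+1.
  rewrite /D; case Ej : (pickle_inv j) => [[n k]|]; last first.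
    by rewrite setCT charge0 divr_ge0 ?exprn_ge0 // ltW.
  have := @pickle_invK (I * nat)%type j; rewrite Ej /= => jE.
  rewrite -jE -lee_fin; apply: le_trans (nuC n k).
  by apply: (m_nu (F := ~` C n k)); apply: open_closedC.
pose E N := F N `&` [set x | forall j, (j < N)%N -> D j x].
have mE M N : m (F M) - e * (1 - 2^-1 ^+ N) <=
    m (F M `&` [set x | forall j, (j < N)%N -> D j x]).
  elim: N => [|N IH].
    by rewrite expr0 subrr mulr0 subr0; apply: le_charge => x; split.
  set B := _ `&` _ in IH; set B' := _ `&` _.
  have : B `<=` B' `|` ~` D N.
    move=> x [Fx Dx]; have [DN|] := pselect (D N x); last by right.
    left; split=> // j; rewrite ltnS leq_eqVlt => /predU1P[->//|]; exact: Dx.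
  move=> /le_charge /le_trans /(_ (chargeU_le _ _)).
  have := mD N; rewrite exprSr invfM -exprVn exprSr.
  move: IH; set t := 2^-1 ^+ N; rewrite !mulrBr !mulrA; clear F0.
  by move: (e * t) (m B) (m B') (m (~` D N)) => a b c d; lra.
have nE N : exists x, E N x.
  apply/set0P/eqP => EN0.
  have := mE N N; rewrite -/(E N) EN0 charge0.
  have /negP := nF N; rewrite -ltNge.
  have : 0 < e * 2^-1 ^+ N by rewrite mulr_gt0 // exprn_gt0 // invr_gt0.
  by rewrite mulrBr; clear F0 EN0; lra.
have [x xE] := choice nE.
have [G [GU xG]] := @ultraFilterLemma _ (x @ \oo) _.
have Gx A : (exists N, forall k, (N <= k)%N -> A (x k)) -> G A.
  by move=> [N h]; apply: xG; exists N.
have GF N : G (F N).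
  apply: Gx; exists N => k Nk; apply: (dF _ _ Nk).
  exact: (xE k).1.
have GD j : G (D j).
  by apply: Gx; exists j.+1 => k jk; apply: (xE k).2.
have lG : forall n, exists l : X n, pr n @ G --> l.
  move=> n; apply: ultC.
  - by move=> A; exact: (in_ultra_setVsetC (pr n @^-1` A) GU).
  - move=> k; have := GD (pickle (n, k)).
    by rewrite /D pickleK_inv.
pose l n := sval (cid (lG n)).
have Gl : G --> (l : XX).
  by apply: prod_topology_cvg => n; exact: svalP (cid (lG n)).
suff : (\bigcap_N F N) l by rewrite F0.
move=> N _; apply: cF => B /Gl GB.
exact: filter_ex (filterI (GF N) GB).
Qed.

(** Covers are increasing sequences of open sets [G N], and a cover is measured
    by the supremum of [m (G N)], not by a sum. For an increasing union the
    estimate is then an estimate on each [G N], and sigma-subadditivity follows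
    by taking the union of the first [N] covers at stage [N]. *)
Definition open_cover_bound (A : set XX) (r : R) :=
  exists G : nat -> set XX, [/\ forall N, open (G N),
    forall M N, (M <= N)%N -> G M `<=` G N,
    A `<=` \bigcup_N G N & forall N, m (G N) <= r].

Definition outer_charge (A : set XX) : R := inf [set r | open_cover_bound A r].
Notation om := outer_charge.

Lemma outer_charge_le A r : open_cover_bound A r -> om A <= r.
Proof.
move=> Ar; apply: ge_inf => //; exists 0 => x [G [_ _ _ /(_ 0%N)]].
exact: le_trans.
Qed.

Lemma open_cover_bound1 A : open_cover_bound A 1.
Proof.
exists (fun=> setT); split=> // [_|x _|_]; first exact: openT.
  by exists 0%N.
exact: charge_le1.
Qed.

Lemma le_outer_charge_bound A c :
  (forall r, open_cover_bound A r -> c <= r) -> c <= om A.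
Proof.
by move=> h; apply: lb_le_inf => //; exists 1; exact: open_cover_bound1.
Qed.

Lemma outer_charge_ge0 A : 0 <= om A.
Proof.
apply: le_outer_charge_bound => r [G [_ _ _ /(_ 0%N)]]; exact: le_trans.
Qed.

Lemma outer_charge0 : om set0 = 0.
Proof.
apply/eqP; rewrite eq_le outer_charge_ge0 andbT; apply: outer_charge_le.
exists (fun=> set0); split=> [_|M N _ x []|x []|_]; first exact: open0.
by rewrite charge0.
Qed.

Lemma le_outer_charge A B : A `<=` B -> om A <= om B.
Proof.
move=> AB; apply: le_outer_charge_bound => r [G [oG nG BG mG]].
by apply: outer_charge_le; exists G; split=> //; exact: subset_trans BG.
Qed.

Lemma outer_charge_lt A e : 0 < e -> open_cover_bound A (om A + e).
Proof.
move=> e0; have : has_inf [set r | open_cover_bound A r].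
  split; first by exists 1; exact: open_cover_bound1.
  by exists 0 => x [G [_ _ _ /(_ 0%N)]]; exact: le_trans.
move=> /(inf_adherent e0)[r [G [oG nG AG mG]] /ltW rle].
by exists G; split=> // N; exact: le_trans (mG N) rle.
Qed.

Lemma outer_charge_sigma_subadditive (A : nat -> set XX) s :
  (forall N, \sum_(j < N) om (A j) <= s) -> om (\bigcup_j A j) <= s.
Proof.
move=> As; apply/ler_addgt0Pr => e e0.
pose ej j : R := e / 2 ^+ j.+1.
have ej0 j : 0 < ej j by rewrite divr_gt0 // exprn_gt0.
have /choice[G hG] := fun j => outer_charge_lt (A j) (ej0 j).
have ejS N : \sum_(j < N) ej j = e * (1 - 2^-1 ^+ N).
  elim: N => [|N IH]; first by rewrite big_ord0 expr0 subrr mulr0.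
  rewrite big_ord_recr /= IH /ej exprSr invfM -exprVn exprSr.
  by rewrite !mulrBr !mulrA; move: (e * _) => t; lra.
have G_sum K N : m (\big[setU/set0]_(j < K) G j N) <=
    \sum_(j < K) (om (A j) + ej j).
  elim: K => [|K IH]; first by rewrite !big_ord0 charge0.
  rewrite !big_ord_recr /=; apply: le_trans (chargeU_le _ _) _.
  by apply: lerD IH _; have [_ _ _] := hG K; exact.
apply: outer_charge_le; exists (fun N => \big[setU/set0]_(j < N) G j N); split.
- move=> N; apply: big_ind => [||j _]; [exact: open0|exact: openU|].
  by have [+ _ _ _] := hG j; exact.
- move=> M N MN; rewrite -(bigcup_mkord M (fun j => G j M)).
  rewrite -(bigcup_mkord N (fun j => G j N)) => x [j /= jM Gx].
  exists j => /=; first exact: leq_trans jM MN.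
  by have [_ nG _ _] := hG j; exact: nG Gx.
- move=> x [j _ Ax]; have [_ nG AG _] := hG j.
  have [N _ GN] := AG _ Ax; exists (maxn N j.+1) => //.
  rewrite -(bigcup_mkord _ (fun j => G j _)); exists j => /=.
    exact: leq_maxr.
  by apply: nG GN; exact: leq_maxl.
- move=> N; apply: le_trans (G_sum N N) _; rewrite big_split /= ejS.
  apply: lerD (As N) _; rewrite ler_piMr ?ltW // gerBl exprn_ge0 //.
Qed.

(** If open sets [G N] increase to a cover of [F], the closed sets
    [F `\` G N] decrease to the empty set, so the cover has at least the mass
    [m F]. *)
Lemma outer_charge_closed F : closed F -> m F <= om F.
Proof.
move=> cF; apply: le_outer_charge_bound => r [G [oG nG FG mG]].
apply/ler_addgt0Pr => e e0.
have [N mN] : exists N, m (F `\` G N) <= e.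
  apply: (charge_closed_vanish (F := fun N => F `\` G N)) => //.
  - by move=> N; apply: closedI => //; exact: open_closedC.
  - by move=> M N MN x [Fx nGx]; split=> // Gx; apply: nGx; exact: nG Gx.
  - apply/seteqP; split=> // x Fx; have [Fx0 _] := Fx 0%N Logic.I.
    by have [N _ GN] := FG _ Fx0; have [_] := Fx N Logic.I.
rewrite (chargeID F (G N)); apply: lerD mN.
by apply: le_trans (mG N); apply: le_charge => x [].
Qed.

(** [U] is the increasing union of the open sets [u > 1/(N+1)], and each of them
    lies in the closed set [u >= 1/(N+1)] inside [U], where [m_nu] applies. The
    same bound may fail for [m] itself. *)
Lemma outer_charge_cylinder n (U : set (X n)) : open U ->
  ((om (pr n @^-1` U))%:E <= nu n U)%E.
Proof.
move=> oU.
have [u [cu u01 UE]] := zero_set_closed (X_polish n) (open_closedC oU).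
have mU' : measurable (U : set (borel (X n))) by exact: open_borel.
have fU : nu n U \is a fin_num by exact: fin_num_measure.
rewrite -(fineK fU) lee_fin; apply: outer_charge_le.
exists (fun N => pr n @^-1` [set y | N.+1%:R^-1 < u y]); split.
- move=> N; apply: open_comp; last exact: open_gt.
  by move=> x _; exact: pr_continuous.
- move=> M N MN x /=; apply: le_lt_trans.
  by rewrite lef_pV2 ?posrE // ler_nat.
- move=> x Ux; have ux : 0 < u (x n).
    rewrite ltNge; apply/negP => ux.
    by have : (~` U) (x n) by [rewrite UE|]; apply.
  have [N _ /(_ N (leqnn N))] := near_infty_natSinv_lt (PosNum ux).
  by exists N.
- move=> N; rewrite -lee_fin fineK //.
  have cU : closed [set y | N.+1%:R^-1 <= u y] by exact: closed_ge.
  apply: le_trans (_ : _ <= nu n [set y | (N.+1%:R^-1 <= u y)%R])%E _.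
    apply: le_trans (m_nu cU); rewrite lee_fin.
    by apply: le_charge => x /= /ltW.
  apply: le_measure; rewrite ?inE //; first exact: closed_borel.
  move=> y /= uy; apply: contrapT => nU; have : (~` U) y by [].
  by rewrite UE /= leNgt (lt_le_trans _ uy) // invr_gt0.
Qed.

(** The metric outer measure property: the two parts sit in disjoint open sets,
    by which any open cover of [A] can be cut without loss. *)
Lemma outer_charge_split (u : XX -> R) a A : continuous u ->
  om (A `&` [set x | a < u x]) + om (A `&` [set x | u x < a]) <= om A.
Proof.
move=> cu; apply: le_outer_charge_bound => r [G [oG nG AG mG]].
rewrite -lerBrDr; apply: outer_charge_le.
exists (fun N => G N `&` [set x | a < u x]); split.
- by move=> N; apply: openI => //; exact: open_gt.
- by move=> M N MN x [Gx ux]; split=> //; exact: nG Gx.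
- by move=> x [Ax ux]; have [N _ GN] := AG _ Ax; exists N.
move=> N; rewrite lerBrDr -lerBrDl; apply: outer_charge_le.
exists (fun N => G N `&` [set x | u x < a]); split.
- by move=> M; apply: openI => //; exact: open_lt.
- by move=> M M' MM x [Gx ux]; split=> //; exact: nG Gx.
- by move=> x [Ax ux]; have [M _ GM] := AG _ Ax; exists M.
move=> M; rewrite lerBrDl; apply: le_trans (mG (maxn N M)).
rewrite -mU; last first.
  by apply/seteqP; split=> // x /= [[_ h1] [_ /(lt_trans h1)]]; rewrite ltxx.
apply: le_charge => x [[Gx _]|[Gx _]]; apply: nG Gx.
  exact: leq_maxl.
exact: leq_maxr.
Qed.

Lemma outer_charge_sigma_subadditivee :
  sigma_subadditive (fun A : set XX => (om A)%:E).
Proof.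
move=> A; have [|] := boolP (\sum_(i <oo) (om (A i))%:E \is a fin_num)%E.
  move=> sfin; rewrite -(fineK sfin) lee_fin.
  apply: outer_charge_sigma_subadditive => N.
  rewrite -lee_fin fineK // -sumEFin.
  rewrite -(big_mkord xpredT (fun j => (outer_charge (A j))%:E)).
  by apply: nneseries_lim_ge => i _ _; rewrite lee_fin outer_charge_ge0.
rewrite fin_numE negb_and !negbK => /orP[/eqP E|/eqP ->]; last by rewrite leey.
have : (0 <= \sum_(i <oo) (om (A i))%:E)%E.
  by apply: nneseries_ge0 => i _ _; rewrite lee_fin outer_charge_ge0.
by rewrite E.
Qed.

Let ome (A : set XX) : \bar R := (om A)%:E.

Let ome0 : ome set0 = 0%E.
Proof. by rewrite /ome outer_charge0. Qed.

Let ome_ge0 A : (0 <= ome A)%E.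
Proof. by rewrite lee_fin outer_charge_ge0. Qed.

Let le_ome : {homo ome : A B / A `<=` B >-> (A <= B)%E}.
Proof. by move=> A B AB; rewrite lee_fin le_outer_charge. Qed.

Definition charge_outer_measure : {outer_measure set XX -> \bar R} :=
  HB.pack ome (isOuterMeasure.Build R XX ome ome0 ome_ge0 le_ome
    outer_charge_sigma_subadditivee).
Notation mu := charge_outer_measure.

(** Cut [A] by [u > d/2] and [u < d/2], where [u] vanishes exactly off [U]. The
    first part, together with the annulus [0 < u < d], covers the trace of [A]
    on the cylinder, and the annulus is small because its outer measure is
    controlled by the sigma-additive [nu n]. *)
Lemma caratheodory_cylinder n (U : set (X n)) : open U ->
  mu.-caratheodory (pr n @^-1` U).
Proof.
move=> oU; apply: le_caratheodory_measurable => A /=.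
have [u [cu u01 UE]] := zero_set_closed (X_polish n) (open_closedC oU).
have U0 y : U y <-> 0 < u y.
  have -> : U y = (~ (~` U) y) :> Prop by rewrite -[in LHS](setCK U).
  by rewrite UE /= ltNge; split=> /negP.
have cun : continuous (u \o pr n).
  by move=> x; apply: continuous_comp; [exact: pr_continuous|exact: cu].
rewrite -EFinD lee_fin; apply/ler_addgt0Pr => e e0.
have [d d0 de] : exists2 d, 0 < d &
    (nu n (U `&` [set y | (u y < d)%R]) <= e%:E)%E.
  apply: contrapT => nd.
  have : (e%:E <= nu n (U `&` [set y | (u y <= 0)%R]))%E.
    apply: measure_inf_level; first exact: open_borel.
      by move=> a; apply: open_borel; exact: open_lt.
    move=> a a0; rewrite leNgt; apply/negP => /ltW h.
    by apply: nd; exists a.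
  suff -> : U `&` [set y | u y <= 0] = set0.
    by rewrite measure0 lee_fin leNgt e0.
  by apply/seteqP; split=> // y [/U0 uy /=]; rewrite leNgt uy.
clear UE.
have h1 := outer_charge_split (d / 2) A cun.
have h2 : om (A `&` ~` (pr n @^-1` U)) <= om (A `&` [set x | u (x n) < d / 2]).
  apply: le_outer_charge => x [Ax nUx]; split=> //=.
  have ux : u (x n) <= 0 by rewrite leNgt; apply/negP => /U0.
  by apply: le_lt_trans ux _; rewrite divr_gt0.
have h3 : om (pr n @^-1` (U `&` [set y | u y < d])) <= e.
  rewrite -lee_fin; apply: le_trans de.
  apply: (@outer_charge_cylinder n (U `&` [set y | u y < d])).
  by apply: openI => //; exact: open_lt.
have h4 : om (A `&` pr n @^-1` U) <= om (A `&` [set x | d / 2 < u (x n)]) +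
   om (pr n @^-1` (U `&` [set y | u y < d])).
  rewrite -lee_fin EFinD; apply: le_trans (outer_measureU2 mu _ _).
  apply: (le_outer_measure mu) => x [Ax Ux].
  have [du|ud] := ltP (d / 2) (u (x n)); [by left|right; split=> //=].
  by apply: le_lt_trans ud _; lra.
by move: h1 h2 h3 h4; rewrite /comp; lra.
Qed.

(** The product of countably many second countable spaces is second countable,
    so open sets are countable unions of finite intersections of cylinders. *)
Lemma caratheodory_borel (A : set (borel XX)) : measurable A ->
  mu.-caratheodory A.
Proof.
suff oC : @open XX `<=` mu.-caratheodory.
  apply: (smallest_sub _ oC).
  exact: (@sigma_algebra_measurable _ (caratheodory_type mu)).
move=> O oO.
pose Bn n := cid (polish_base (X_polish n)).
pose B n := sval (Bn n).
have oB n k : open (B n k) by have [h _] := svalP (Bn n); exact: h.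
have BN n x A' : nbhs x A' -> exists k, B n k x /\ B n k `<=` A'.
  by have [_ h] := svalP (Bn n); exact: h.
(* finite intersections of cylinders, indexed by a countable type *)
pose cyl (s : seq (I * nat)) : set XX :=
  [set x | forall p, p \in s -> B p.1 p.2 (x p.1)].
have mcyl s : mu.-caratheodory (cyl s).
  elim: s => [|[n k] s IH].
    have -> : cyl [::] = setT by apply/seteqP; split.
    by move=> Y; rewrite setIT setCT setI0 outer_measure0 adde0.
  have -> : cyl ((n, k) :: s) = pr n @^-1` (B n k) `&` cyl s.
    apply/seteqP; split=> x /=.
      move=> h; split; first by apply: (h (n, k)); rewrite mem_head.
      by move=> p ps; apply: h; rewrite inE ps orbT.
    by move=> [h1 h2] p; rewrite inE => /predU1P[->//|]; exact: h2.
  apply: caratheodory_measurable_setI => //.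
  by apply: caratheodory_cylinder.
have OE : O = \bigcup_s (if `[< cyl s `<=` O >] then cyl s else set0).
  apply/seteqP; split=> x /=; last first.
    by move=> [s _]; case: asboolP => // sO; exact: sO.
  move=> Ox.
  pose F : set_system XX := [set A' | exists s, cyl s x /\ cyl s `<=` A'].
  have FF : Filter F.
    split.
    - by exists [::]; split=> // p.
    - move=> P Q [s [sx sP]] [t [tx tQ]]; exists (s ++ t); split.
        by move=> p; rewrite mem_cat => /orP[]; [exact: sx|exact: tx].
      move=> y sty; split; [apply: sP|apply: tQ] => p ps; apply: sty;
        by rewrite mem_cat ps ?orbT.
    - move=> P Q PQ [s [sx sP]]; exists s; split=> //.
      exact: subset_trans PQ.
  have : F --> x.
    apply: prod_topology_cvg => n W /(BN n) [k [Bx BW]].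
    exists [:: (n, k)]; split.
      by move=> p; rewrite inE => /eqP ->.
    by move=> y h; apply: BW; apply: (h (n, k)); rewrite inE.
  have /[swap]/[apply] : nbhs x O by exact: open_nbhs_nbhs.
  move=> [s [sx sO]]; exists s => //.
  by case: asboolP.
rewrite OE.
apply: (@countable_bigcupT_measurable _ (caratheodory_type mu)) => // s.
by case: ifP => _; [exact: mcyl|exact: measurable0].
Qed.

Let mub (A : set (borel XX)) : \bar R := mu A.

Let mub0 : mub set0 = 0%E.
Proof. exact: outer_measure0. Qed.

Let mub_ge0 A : (0 <= mub A)%E.
Proof. exact: outer_measure_ge0. Qed.

Let mub_additive : semi_sigma_additive mub.
Proof.
move=> F mF tF mUF; apply: (@caratheodory_measure_sigma_additive _ _ mu) => //.
  by move=> i; exact: caratheodory_borel.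
exact: caratheodory_borel.
Qed.

Let mub_measure := isMeasure.Build _ (borel XX) R mub mub0 mub_ge0 mub_additive.

Let mub_measure' : {measure set (borel XX) -> \bar R} :=
  HB.pack mub mub_measure.

Let mubT : mub_measure' setT = 1%E.
Proof.
apply/eqP; rewrite eq_le !lee_fin; apply/andP; split.
  exact/outer_charge_le/open_cover_bound1.
by rewrite -mT; apply: outer_charge_closed; exact: closedT.
Qed.

Definition charge_probability : probability (borel XX) R :=
  HB.pack_for (probability (borel XX) R) mub mub_measure
    (Measure_isProbability.Build _ (borel XX) R mub_measure' mubT).

Lemma charge_probability_closed (F : set XX) : closed F ->
  ((m F)%:E <= charge_probability F)%E.
Proof. by move=> cF; rewrite /= lee_fin; exact: outer_charge_closed. Qed.

Hypothesis nuT : forall n, nu n setT = 1%E.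

Lemma charge_probability_open n (U : set (X n)) : open U ->
  (charge_probability (pr n @^-1` U) <= nu n U)%E.
Proof. by move=> oU; exact: outer_charge_cylinder. Qed.

Lemma charge_probability_closed_le n (F : set (X n)) : closed F ->
  (charge_probability (pr n @^-1` F) <= nu n F)%E.
Proof.
move=> cF; have [u [cu u01 FE]] := zero_set_closed (X_polish n) cF.
rewrite [in leRHS]FE -[X in nu n X]setTI; apply: measure_inf_level => //.
  by move=> a; apply: open_borel; exact: open_lt.
move=> a a0; rewrite setTI.
apply: le_trans (charge_probability_open (open_lt a cu)).
apply: le_outer_measure => x /=; rewrite {1}FE /= => /le_lt_trans; exact.
Qed.

Lemma pr_measurable n :
  measurable_fun setT (pr n : borel XX -> borel (X n)).
Proof.
apply: (@measurability _ _ (borel XX) (borel (X n)) _ _ (@open (X n))) => //.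
move=> _ [U oU <-]; rewrite setTI; apply: open_borel.
by apply: open_comp => // x _; exact: pr_continuous.
Qed.

(** Both measures have mass [1] and one is below the other on open sets and on
    closed sets, so they agree on open sets. *)
Lemma charge_probability_marginal n (A : set (borel (X n))) : measurable A ->
  pushforward charge_probability (pr n : borel XX -> borel (X n)) A = nu n A.
Proof.
move=> mA; pose p := charge_probability.
have UE (U : set (X n)) : open U -> p (pr n @^-1` U) = nu n U.
  move=> oU; apply/eqP; rewrite eq_le charge_probability_open //=.
  have mU' : measurable (U : set (borel (X n))) by exact: open_borel.
  have mpU : measurable (pr n @^-1` U : set (borel XX)).
    by rewrite -[X in measurable X]setTI; exact: pr_measurable.
  have := charge_probability_closed_le (open_closedC oU).
  rewrite preimage_setC (probability_setC p mpU).
  have mCU : measurable (~` U : set (borel (X n))) by exact: measurableC.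
  have : nu n (U `|` ~` U) = (nu n U + nu n (~` U))%E.
    by apply: measureU => //; rewrite setICr.
  rewrite setUv (nuT n : nu n [set: X n] = 1%E).
  rewrite -(fineK (fin_num_measure (nu n) _ mU')).
  rewrite -(fineK (fin_num_measure (nu n) _ mCU)).
  rewrite -(fineK (fin_num_measure p _ mpU)).
  rewrite -EFinB -EFinD !lee_fin /= => -[].
  by move: (fine _) (fine _) (om _) => a b c; lra.
pose mp : {measure set (borel (X n)) -> \bar R} :=
  pushforward p (pr n : borel XX -> borel (X n)).
have Gm : @open (X n) `<=` (measurable : set (set (borel (X n)))).
  exact: sub_sigma_algebra.
suff : forall B, <<s @open (X n) >> B -> mp (@pr_measurable n) B = nu n B.
  by move=> /(_ A mA).
apply: (@g_sigma_algebra_measure_unique _ R (borel (X n)) (@open (X n)) Gm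
  (fun=> setT) _ _ (mp (@pr_measurable n)) (nu n)).
- by move=> _; exact: openT.
- by rewrite bigcup_const //; exists 0%N.
- by move=> U V; exact: openI.
- exact: UE.
- move=> k; have -> : mp (@pr_measurable n) setT = p setT by [].
  by rewrite probability_setT ltry.
Qed.

Lemma exists_probability_above_charge : exists mu : probability (borel XX) R,
  (forall n (A : set (borel (X n))), measurable A ->
    pushforward mu (pr n : borel XX -> borel (X n)) A = nu n A) /\
  forall F : set XX, closed F -> ((m F)%:E <= mu F)%E.
Proof.
exists charge_probability; split; [exact: charge_probability_marginal|].
exact: charge_probability_closed.
Qed.

End Charge.

(** * Bounded functions and the weak topology of measures *)

Section BoundedFunctions.
Context {R : realType}.

Definition bdd (T : Type) : set (T -> R) :=
  [set h | exists M, forall x, `|h x| <= M].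

Lemma bounded_funP (T : Type) (h : T -> R) : bounded_fun h <-> bdd h.
Proof.
split=> [[M [_ hM]]|[M hM]].
  by exists (M + 1) => x; apply: (hM (M + 1)) => //; rewrite ltrDl.
exists M; split; first exact: num_real.
by move=> N MN x _; apply: le_trans (hM x) (ltW MN).
Qed.

Lemma bdd_cst (T : Type) (c : R) : @bdd T (cst c).
Proof. by exists `|c|. Qed.

Lemma bddD (T : Type) (g h : T -> R) : bdd g -> bdd h -> bdd (g \+ h).
Proof.
move=> [M gM] [N hN]; exists (M + N) => x.
by apply: le_trans (ler_normD _ _) _; exact: lerD.
Qed.

Lemma bddZ (T : Type) (t : R) (g : T -> R) : bdd g -> bdd (fun x => t * g x).
Proof.
by move=> [M gM]; exists (`|t| * M) => x; rewrite normrM ler_wpM2l.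
Qed.

Lemma bddN (T : Type) (g : T -> R) : bdd g -> bdd (fun x => - g x).
Proof. by move=> [M gM]; exists M => x; rewrite normrN. Qed.

Lemma usc_measurable (T : ptopologicalType) (f : T -> R) :
  upper_semicontinuous f -> measurable_fun [set: borel T] (f : borel T -> R).
Proof.
move=> uf.
apply: (measurability _ (measurable_realfun.RGenInftyO.measurableE R)) => //.
move=> _ [_ [a ->] <-]; rewrite setTI; apply: open_borel.
have -> : f @^-1` `]-oo, a[ = [set x | f x < a].
  by apply/seteqP; split=> x /=; rewrite in_itv.
by rewrite openE => x /= fa; exact: uf.
Qed.

Lemma Cb_measurable (T : ptopologicalType) (g : T -> R) : Cb g ->
  measurable_fun [set: borel T] (g : borel T -> R).
Proof.
move=> [_ cg]; apply: usc_measurable => x a ga.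
exact: (cvgr_lt _ (cg x)).
Qed.

Lemma bdd_integrable (T : ptopologicalType)
    (nu : {finite_measure set (borel T) -> \bar R}) (g : T -> R) :
  bdd g -> measurable_fun [set: borel T] (g : borel T -> R) ->
  nu.-integrable [set: borel T] (EFin \o (g : borel T -> R)).
Proof.
move=> bg mg; apply: measurable_bounded_integrable => //.
  by rewrite -ge0_fin_numE // fin_num_measure.
exact/bounded_funP.
Qed.

Lemma CbD (T : topologicalType) (g h : T -> R) : Cb g -> Cb h -> Cb (g \+ h).
Proof.
move=> [/bounded_funP bg cg] [/bounded_funP bh ch]; split.
  by apply/bounded_funP; exact: bddD.
by move=> x; apply: cvgD; [exact: cg|exact: ch].
Qed.

Lemma CbZ (T : topologicalType) t (g : T -> R) : Cb g -> Cb (fun x => t * g x).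
Proof.
move=> [/bounded_funP bg cg]; split; first by apply/bounded_funP; exact: bddZ.
by move=> x; apply: cvgM; [exact: cvg_cst|exact: cg].
Qed.

Lemma Cb_cst (T : topologicalType) (c : R) : @Cb R T (cst c).
Proof.
split; first by apply/bounded_funP; exact: bdd_cst.
by move=> x; exact: cvg_cst.
Qed.

Lemma Rintegral_continuous (T : ptopologicalType) (g : T -> R) : Cb g ->
  continuous (fun nu : ca_plus R T => \int[nu]_(x in [set: borel T]) g x).
Proof.
move=> Cg nu.
pose gi : {g : T -> R | @Cb R T g} := exist _ g Cg.
have /cvg_sup/(_ gi) h : nbhs nu --> nu by exact: cvg_id.
move=> A nA; apply: h.
exact: (@initial_continuous _ _ (fun nu : ca_plus R T =>
  \int[nu]_(x in [set: borel T]) g x) nu A nA).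
Qed.

End BoundedFunctions.

(** * Functionals dominated by a compact convex set of measures *)

Section MarginalChoice.
Context {R : realType} {T : ptopologicalType}.
Variable P : set (ca_plus R T).
Hypothesis P_proba : forall nu : ca_plus R T, P nu -> nu [set: T] = 1%E.
Hypothesis P_nonempty : P !=set0.
Hypothesis P_convex : convex_measures P.
Hypothesis P_compact : compact P.
Implicit Types (nu : ca_plus R T) (g h : T -> R).

Notation ev nu g := (\int[nu]_(x in [set: borel T]) (g : borel T -> R) x).
Notation W := (@Cb R T : set (T -> R^o)).

Lemma Cb0 : W 0.
Proof. exact: (Cb_cst T 0). Qed.

Lemma Cb_add (u v : T -> R^o) : W u -> W v -> W (u + v).
Proof. exact: CbD. Qed.

Lemma Cb_scale (t : R) (u : T -> R^o) : W u -> W (t *: u).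
Proof. exact: CbZ. Qed.

Lemma Cb_integrable nu g : Cb g ->
  nu.-integrable [set: borel T] (EFin \o (g : borel T -> R)).
Proof.
move=> Cg; apply: bdd_integrable; last exact: Cb_measurable.
by case: Cg => /bounded_funP.
Qed.

Lemma Rintegral_linear nu : linear_on W (fun g : T -> R^o => ev nu g).
Proof.
split=> [u v Wu Wv|t u Wu].
  by apply: RintegralD => //; exact: Cb_integrable.
by apply: RintegralZl => //; exact: Cb_integrable.
Qed.

Lemma Rintegral_cst_proba nu c : P nu -> ev nu (cst c) = c.
Proof.
move=> Pnu; transitivity (c * fine (nu [set: T])); last first.
  by rewrite P_proba // mulr1.
exact: (Rintegral_cst _ measurableT).
Qed.

(** [P_convex] speaks of measures of sets, and integration against a sum of
    measures is additive for nonnegative functions; hence the shift of [g] by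
    a bound [M]. *)
Lemma Rintegral_convex mu nu (t : R) : P mu -> P nu -> 0 <= t <= 1 ->
  exists2 rho, P rho &
    forall g, Cb g -> ev rho g = t * ev mu g + (1 - t) * ev nu g.
Proof.
move=> Pmu Pnu t01; have [rho Prho rhoE] := P_convex Pmu Pnu t01.
exists rho => // g Cg; have [/bounded_funP[M gM] _] := Cg.
have /andP[t0 t1] := t01; have s0 : 0 <= 1 - t by rewrite subr_ge0.
pose h := g \+ cst M.
have Ch : Cb h by apply: CbD => //; exact: Cb_cst.
have h0 x : 0 <= h x.
  rewrite /h /= -lerBlDr sub0r.
  by have := gM x; rewrite ler_norml => /andP[].
have evh la : P la -> ev la h = ev la g + M.
  move=> Pla; rewrite -[in RHS](Rintegral_cst_proba M Pla).
  by apply: RintegralD => //; apply: Cb_integrable => //; exact: Cb_cst.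
suff : ev rho h = t * ev mu h + (1 - t) * ev nu h.
  by rewrite !evh //; move: (ev rho g) (ev mu g) (ev nu g) => a b c; nra.
pose hE (x : borel T) : \bar R := (h x)%:E.
have mh : measurable_fun [set: borel T] hE.
  by apply/measurable_EFinP; exact: Cb_measurable.
have h0e (x : borel T) : [set: borel T] x -> (0 <= hE x)%E.
  by move=> _; rewrite lee_fin.
pose m1 : {measure set (borel T) -> \bar R} := mscale (NngNum t0) mu.
pose m2 : {measure set (borel T) -> \bar R} := mscale (NngNum s0) nu.
have m1E A : m1 A = (t%:E * mu A)%E by [].
have m2E A : m2 A = ((1 - t)%:E * nu A)%E by [].
have E : (\int[rho]_(x in [set: borel T]) hE x =
   t%:E * \int[mu]_(x in [set: borel T]) hE x +
   (1 - t)%:E * \int[nu]_(x in [set: borel T]) hE x)%E.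
  rewrite (eq_measure_integral (measure_add m1 m2)); last first.
    by move=> A mA _; have := rhoE A mA; rewrite -m1E -m2E -measure_addE.
  by rewrite ge0_integral_measure_add // !ge0_integral_mscale.
have fin (la : ca_plus R T) :
    (\int[la]_(x in [set: borel T]) hE x)%E \is a fin_num.
  exact: (integrable_fin_num measurableT (Cb_integrable la Ch)).
by rewrite /Rintegral E fineD ?fineM // fin_numM.
Qed.

Variable L : (T -> R) -> R.
Hypothesis L_linear : linear_on (W : set (T -> R^o)) (L : (T -> R^o) -> R).
Hypothesis L_le : forall g, Cb g ->
  ((L g)%:E <= ereal_sup [set (ev nu g)%:E | nu in P])%E.

(** Least squares in place of a separation theorem. Let [p] in [P] minimize the
    sum of the squared errors [w g = ev p g - L g], and let [h] be the sum of
    the [w g *: g]. By convexity [p] minimizes [ev nu h] over [P], so [L_le],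
    applied to [- h], gives [ev p h <= L h]. But [ev p h - L h] is the sum of
    the squares of the [w g], which therefore vanish. *)
Lemma finite_moments (gs : seq (T -> R^o)) : (forall g, g \in gs -> W g) ->
  exists2 nu, P nu & forall g, g \in gs -> ev nu g = L g.
Proof.
move=> Wgs.
have cs (s : seq (T -> R^o)) : (forall g, g \in s -> W g) ->
    continuous (fun nu : ca_plus R T => \sum_(g <- s) (ev nu g - L g) ^+ 2).
  elim: s => [|g s IH] Ws.
    rewrite (_ : (fun _ => _) = cst 0); first exact: cst_continuous.
    by apply/funext => nu; rewrite big_nil.
  pose d (nu : ca_plus R T) : R := ev nu g - L g.
  rewrite (_ : (fun _ => _) = fun nu : ca_plus R T =>
      d nu * d nu + \sum_(g <- s) (ev nu g - L g) ^+ 2); last first.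
    by apply/funext => nu; rewrite big_cons expr2.
  have cd nu : {for nu, continuous d}.
    have cg : {for nu, continuous (fun nu : ca_plus R T => ev nu g)}.
      by apply: Rintegral_continuous; apply: Ws; rewrite mem_head.
    have cL : {for nu, continuous (cst (L g) : ca_plus R T -> R)}.
      exact: cst_continuous.
    exact: (continuousB cg cL).
  move=> nu.
  have cIH : {for nu, continuous (fun nu : ca_plus R T =>
      \sum_(g <- s) (ev nu g - L g) ^+ 2)}.
    by apply: IH => v vs; apply: Ws; rewrite inE vs orbT.
  exact: (continuousD (continuousM (cd nu) (cd nu)) cIH).
pose F (nu : ca_plus R T) : R := \sum_(g <- gs) (ev nu g - L g) ^+ 2.
have cF : continuous F by exact: cs.
have [p /set_mem Pp pmin] :
    exists2 c, c \in P & forall t, t \in P -> F c <= F t.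
  by apply: compact_EVT_min => //; apply: continuous_subspaceT.
pose w (g : T -> R^o) : R := ev p g - L g.
have wq q : P q -> 0 <= \sum_(g <- gs) w g * (ev q g - ev p g).
  move=> Pq; pose v (g : T -> R^o) := ev q g - ev p g.
  pose s := \sum_(g <- gs) w g * v g; pose V := \sum_(g <- gs) v g ^+ 2.
  have V0 : 0 <= V by apply: sumr_ge0 => g _; exact: sqr_ge0.
  have st (t : R) : 0 < t -> t <= 1 -> 0 <= 2 * s + t * V.
    move=> t0 t1; have t01 : 0 <= t <= 1 by rewrite ltW.
    have [rho Prho rhoE] := Rintegral_convex Pq Pp t01.
    have := pmin rho (mem_set Prho).
    have -> : F rho = F p + t * (2 * s + t * V).
      rewrite /F /s /V !mulr_sumr -big_split /= mulr_sumr -big_split /=.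
      rewrite [LHS]big_seq [RHS]big_seq; apply: eq_bigr => g gg.
      by rewrite (rhoE _ (Wgs _ gg)) /w /v; ring.
    by rewrite lerDl pmulr_rge0.
  rewrite -/s leNgt; apply/negP => s0.
  (* small enough for the quadratic term not to undo the linear decrease *)
  pose t := Num.min 1 (- s / (V + 1)).
  have V1 : 0 < V + 1 by rewrite ltr_wpDl.
  have t0 : 0 < t by rewrite lt_min ltr01 divr_gt0 // oppr_gt0.
  have := st t t0; rewrite ge_min lexx => /(_ isT).
  have : t * V <= - s.
    have : t <= - s / (V + 1) by rewrite ge_min lexx orbT.
    rewrite ler_pdivlMr // => h; apply: le_trans h.
    by rewrite ler_wpM2l //; [exact: ltW|rewrite lerDl].
  lra.
have [Wh _] := linear_on_sum Cb0 Cb_add Cb_scale w L_linear Wgs.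
have Lh := (linear_on_sum Cb0 Cb_add Cb_scale w L_linear Wgs).2.
have evh nu :=
  (linear_on_sum Cb0 Cb_add Cb_scale w (Rintegral_linear nu) Wgs).2.
set h := \sum_(v <- gs) w v *: v in Wh Lh evh.
have qh q : P q -> ev p h <= ev q h.
  move=> Pq; rewrite !evh -subr_ge0 -sumrB.
  by under eq_bigr do rewrite -mulrBr; exact: wq.
have : ev p h <= L h.
  have WNh : W (- 1 *: h) by exact: Cb_scale.
  have : ((L (- 1 *: h))%:E <= (- ev p h)%:E)%E.
    apply: le_trans (L_le WNh) _; apply: ge_ereal_sup => _ [q Pq <-].
    by rewrite lee_fin (Rintegral_linear q).2 // mulN1r lerN2 qh.
  by rewrite lee_fin L_linear.2 // mulN1r lerN2.
rewrite evh Lh -subr_ge0 -sumrB => w0.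
exists p => // g gg; apply/eqP; rewrite -subr_eq0 -sqrf_eq0.
have w2 : \sum_(g <- gs) w g ^+ 2 <= 0.
  rewrite -oppr_ge0 -sumrN; apply: le_trans w0 _.
  rewrite le_eqVlt; apply/orP; left; apply/eqP; apply: eq_bigr => u _.
  by rewrite /w; ring.
have : \sum_(g <- gs) w g ^+ 2 == 0.
  by rewrite eq_le w2 sumr_ge0 // => u _; exact: sqr_ge0.
rewrite psumr_eq0 => [/allP/(_ _ gg)//|u _]; exact: sqr_ge0.
Qed.

(** The measures with prescribed integrals of finitely many functions form a
    filter base on the compact set [P]; any cluster point has all the prescribed
    integrals. *)
Lemma exists_marginal : exists2 nu, P nu & forall g, Cb g -> L g = ev nu g.
Proof.
pose F : set_system (ca_plus R T) := [set A | exists gs : seq (T -> R^o),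
  (forall g, g \in gs -> W g) /\
  forall nu, P nu -> (forall g, g \in gs -> ev nu g = L g) -> A nu].
have FF : ProperFilter F.
  split.
    by move=> [gs [Wgs h]]; have [nu Pnu /(h _ Pnu)] := finite_moments Wgs.
  split.
  - by exists [::]; split.
  - move=> A B [s [Ws hA]] [t [Wt hB]]; exists (s ++ t); split.
      by move=> g; rewrite mem_cat => /orP[]; [exact: Ws|exact: Wt].
    move=> nu Pnu h; split; [apply: hA|apply: hB] => // g gs; apply: h;
      by rewrite mem_cat gs ?orbT.
  - by move=> A B AB [s [Ws hA]]; exists s; split=> // nu Pnu h; exact/AB/hA.
have FP : F P by exists [::]; split.
have [nu [Pnu Fnu]] := P_compact FF FP.
exists nu => // g Cg; apply/eqP; rewrite -subr_eq0 -normr_le0.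
apply/ler_addgt0Pr => e e0; rewrite add0r.
have FA : F [set la | ev la g = L g].
  exists [:: (g : T -> R^o)]; split.
    by move=> v; rewrite inE => /eqP ->.
  by move=> la Pla h; apply: h; rewrite inE.
have NB : nbhs nu [set la : ca_plus R T | `|ev nu g - ev la g| < e].
  by have /cvgrPdist_lt /(_ e e0) := @Rintegral_continuous R T g Cg nu.
have [la [/= <- h]] := Fnu _ _ FA NB.
by rewrite distrC; exact: ltW.
Qed.

End MarginalChoice.

(** * Sums of extended reals over a countable type *)

Section ExtendedSums.
Context {R : realType} {I : countType}.
Local Open Scope ereal_scope.

Lemma esum_single (a : I -> \bar R) n : 0 <= a n ->
  (forall k, k != n -> a k = 0) -> \esum_(k in [set: I]) a k = a n.
Proof.
move=> an0 ak0; rewrite -[RHS]esum_set1 // [RHS]esum_mkcond.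
apply: eq_esum => k _.
case: ifPn => //; rewrite notin_setE /= => /eqP; exact: ak0.
Qed.

Lemma esumZl (a : I -> \bar R) (t : R) : (0 < t)%R -> (forall k, 0 <= a k) ->
  \esum_(k in [set: I]) (t%:E * a k) = t%:E * \esum_(k in [set: I]) a k.
Proof.
have le (b : I -> \bar R) (s : R) : (0 < s)%R -> (forall k, 0 <= b k) ->
    \esum_(k in [set: I]) (s%:E * b k) <= s%:E * \esum_(k in [set: I]) b k.
  move=> s0 b0; apply: ge_ereal_sup => _ [A [finA AI] <-].
  rewrite -ge0_mule_fsumr //; apply: lee_wpmul2l; first by rewrite lee_fin ltW.
  by apply: ereal_sup_ubound; exists A.
move=> t0 a0; apply/eqP; rewrite eq_le le //=.
have ti : (0 < t^-1)%R by rewrite invr_gt0.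
have ta k : 0 <= t%:E * a k by rewrite mule_ge0 // lee_fin ltW.
have := le _ _ ti ta.
under eq_esum do rewrite muleA -EFinM mulVf ?gt_eqF // mul1e.
move=> /(lee_wpmul2l (x := t%:E)); rewrite lee_fin => /(_ (ltW t0)).
move=> /le_trans; apply.
by rewrite muleA -EFinM mulfV ?gt_eqF // mul1e.
Qed.

Lemma esum_pickle (a : I -> \bar R) : (forall k, 0 <= a k) ->
  \esum_(i in [set: I]) a i =
  \sum_(k <oo) (if @pickle_inv I k is Some i then a i else 0).
Proof.
move=> a0; pose b k := if @pickle_inv I k is Some i then a i else 0.
have b0 k : 0 <= b k by rewrite /b; case: pickle_inv.
rewrite nneseries_esumT //.
transitivity (\esum_(j in range (@pickle I)) b j).
  rewrite (@reindex_esum _ _ _ setT _ (@pickle I)); last first.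
    by apply: inj_bij => x y _ _; exact: (pcan_inj pickleK).
  by apply: eq_esum => i _; rewrite /b pickleK_inv.
rewrite esum_mkcond; apply: eq_esum => k _; case: ifPn => //.
rewrite notin_setE /= => nk; rewrite /b; case E : (pickle_inv k) => [i|//].
by exfalso; apply: nk; exists i => //; have := @pickle_invK I k; rewrite E.
Qed.

End ExtendedSums.

(** * Sublinearity of the primal functional *)

Section CostFunctional.
Context {R : realType} {I : countType} {X : I -> ptopologicalType}.
Variable P : forall n, set (ca_plus R (X n)).
Arguments P : clear implicits.
Hypothesis P_proba : forall n (nu : ca_plus R (X n)),
  P n nu -> nu [set: X n] = 1%E.
Hypothesis P_nonempty : forall n, P n !=set0.
Notation XX := (prod_topology X).
Notation phim n := (phi_marginal (P n)).

Lemma Bb_plus_EFin (T : ptopologicalType) (g : T -> R) : Bb_plus g ->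
  measurable_fun [set: borel T] (fun x : borel T => (g x)%:E) /\
  (forall x : borel T, [set: borel T] x -> (0 <= (g x)%:E)%E).
Proof.
move=> [_ g0 mg]; split; first exact/measurable_EFinP.
by move=> x _; rewrite lee_fin.
Qed.

Lemma phi_marginal_ub n nu (g : X n -> R) : P n nu ->
  (\int[nu]_(x in [set: borel (X n)]) (g x)%:E <= phim n g)%E.
Proof. by move=> Pnu; apply: ereal_sup_ubound; exists nu. Qed.

Lemma phi_marginal_ge0 n (g : X n -> R) : (forall x, 0 <= g x) ->
  (0 <= phim n g)%E.
Proof.
move=> g0; have [nu Pnu] := P_nonempty n.
apply: le_trans (phi_marginal_ub g Pnu).
by apply: integral_ge0 => x _; rewrite lee_fin.
Qed.

Lemma phi_marginal0 n : phim n (fun=> 0) = 0%E.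
Proof.
apply/eqP; rewrite eq_le phi_marginal_ge0 // andbT.
by apply: ge_ereal_sup => _ [nu Pnu <-]; rewrite integral0.
Qed.

Lemma phi_marginalD n (g h : X n -> R) : Bb_plus g -> Bb_plus h ->
  (phim n (g \+ h)%R <= phim n g + phim n h)%E.
Proof.
move=> Bg Bh; apply: ge_ereal_sup => _ [nu Pnu <-].
have [mg g0] := Bb_plus_EFin Bg; have [mh h0] := Bb_plus_EFin Bh.
under eq_integral do rewrite EFinD.
by rewrite ge0_integralD //; apply: leeD; exact: phi_marginal_ub.
Qed.

Lemma phi_marginalZ n (t : R) (g : X n -> R) : 0 <= t -> Bb_plus g ->
  (phim n (fun x => t * g x)%R <= t%:E * phim n g)%E.
Proof.
move=> t0 Bg; apply: ge_ereal_sup => _ [nu Pnu <-].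
have [mg g0] := Bb_plus_EFin Bg.
under eq_integral do rewrite EFinM.
rewrite ge0_integralZl_EFin //; apply: lee_wpmul2l; rewrite ?lee_fin //.
exact: phi_marginal_ub.
Qed.

Lemma Bb_plusD (T : ptopologicalType) (g h : T -> R) :
  Bb_plus g -> Bb_plus h -> Bb_plus (g \+ h).
Proof.
move=> [/bounded_funP bg g0 mg] [/bounded_funP bh h0 mh]; split.
- by apply/bounded_funP; exact: bddD.
- by move=> x /=; exact: addr_ge0.
- exact: measurable_funD.
Qed.

Lemma Bb_plusZ (T : ptopologicalType) (t : R) (g : T -> R) :
  0 <= t -> Bb_plus g -> Bb_plus (fun x => t * g x).
Proof.
move=> t0 [/bounded_funP bg g0 mg]; split.
- by apply/bounded_funP; exact: bddZ.
- by move=> x /=; exact: mulr_ge0.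
- by apply: measurable_funM.
Qed.

Lemma Bb_plus0 (T : ptopologicalType) : @Bb_plus R T (fun=> 0).
Proof. by split=> //; exact/bounded_funP/bdd_cst. Qed.

Definition hedge (h : XX -> R) (m : R) (g : forall n, X n -> R) :=
  (forall n, Bb_plus (g n)) /\ forall x, ((h x)%:E <= m%:E + oplus g x)%E.

Definition cost (m : R) (g : forall n, X n -> R) : \bar R :=
  (m%:E + \esum_(n in [set: I]) phim n (g n))%E.

Lemma phi_le_cost h m g : hedge h m g -> (phi P h <= cost m g)%E.
Proof. by move=> [Bg hg]; apply: ereal_inf_lbound; exists m, g. Qed.

Lemma le_phi h (c : \bar R) :
  (forall m g, hedge h m g -> (c <= cost m g)%E) -> (c <= phi P h)%E.
Proof.
move=> hc; apply: le_ereal_inf_tmp => _ [m [g [Bg hg ->]]].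
exact: hc.
Qed.

Lemma oplus0 (x : XX) : oplus (fun n => fun _ : X n => 0 : R) x = 0%E.
Proof. exact: esum1. Qed.

Lemma phi_le_sup h (M : R) : (forall x, h x <= M) -> (phi P h <= M%:E)%E.
Proof.
move=> hM; have : hedge h M (fun n => fun _ : X n => 0).
  split=> [n|x]; first exact: Bb_plus0.
  by rewrite oplus0 adde0 lee_fin.
move=> /phi_le_cost /le_trans; apply.
by rewrite /cost esum1 ?adde0 // => n _; exact: phi_marginal0.
Qed.

Lemma exists_le_integral (T : ptopologicalType) (nu : ca_plus R T)
    (g : T -> R) :
  nu [set: T] = 1%E -> Bb_plus g ->
  exists x, ((g x)%:E <= \int[nu]_(x in [set: borel T]) (g x)%:E)%E.
Proof.
move=> nuT [/bounded_funP bg g0 mg]; apply: contrapT => /forallNP nx.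
have ig := bdd_integrable nu bg mg.
pose c := fine (\int[nu]_(x in [set: borel T]) (g x)%:E).
have cE : (\int[nu]_(x in [set: borel T]) (g x)%:E)%E = c%:E.
  by rewrite /c fineK //; exact: (integrable_fin_num measurableT ig).
have gc x : c < g x.
  by have := nx x; rewrite cE lee_fin => /negP; rewrite -ltNge.
have ic : nu.-integrable [set: borel T] (EFin \o (cst c : borel T -> R)).
  by apply: bdd_integrable => //; exact: bdd_cst.
have icst : (\int[nu]_(x in [set: borel T]) c%:E = c%:E)%E.
  transitivity (c%:E * nu [set: T])%E; last by rewrite nuT mule1.
  exact: (integral_cst nu measurableT c%:E).
have int0 : (\int[nu]_(x in [set: borel T]) `|(g x)%:E - c%:E| = 0)%E.
  under eq_integral => x _ do
    rewrite -EFinB abse_EFin ger0_norm ?subr_ge0 ?(ltW (gc x)) // EFinB.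
  rewrite (integralB measurableT ig ic) cE.
  by rewrite icst subee.
have mgc : measurable_fun [set: borel T] (fun x : borel T => (g x)%:E - c%:E)%E.
  by apply: emeasurable_funB => //; exact/measurable_EFinP.
have /(ae_eq_integral_abs nu measurableT mgc) [N [mN N0 sN]] := int0.
have NT : [set: borel T] `<=` N.
  move=> x _; apply: sN => /= /(_ Logic.I) /eqP.
  by rewrite -EFinB eqe subr_eq0 gt_eqF.
have : (nu [set: borel T] <= nu N)%E by apply: le_measure; rewrite ?inE.
by rewrite N0 (nuT : nu [set: borel T] = 1%E) lee_fin ler10.
Qed.

(** Evaluating a hedge at a point whose coordinates satisfy
    [g n (x n) <= phim n (g n)] bounds its cost from below. *)
Lemma phi_ge_inf h (c : R) : (forall x, c <= h x) -> (c%:E <= phi P h)%E.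
Proof.
move=> ch; apply: le_phi => m g [Bg hg].
have h1 n : exists x, ((g n x)%:E <= phim n (g n))%E.
  have [nu Pnu] := P_nonempty n.
  have [x gx] := exists_le_integral (P_proba Pnu) (Bg n).
  by exists x; apply: le_trans gx (phi_marginal_ub _ Pnu).
pose x : XX := fun n => sval (cid (h1 n)).
apply: (@le_trans _ _ (h x)%:E); first by rewrite lee_fin.
apply: le_trans (hg x) _; apply: leeD => //; apply: le_esum => n _.
exact: svalP (cid (h1 n)).
Qed.

Notation W := (@bdd R XX : set (XX -> R^o)).

Lemma phi_fin_num h : bdd h -> phi P h \is a fin_num.
Proof.
move=> [M hM]; rewrite fin_numElt; apply/andP; split.
  apply: lt_le_trans (ltNyr (- M)) (phi_ge_inf (c := - M) _) => x.
  by have := hM x; rewrite ler_norml => /andP[].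
apply: le_lt_trans (phi_le_sup (M := M) _) (ltry M) => x.
exact: le_trans (ler_norm _) (hM x).
Qed.

Definition rphi (h : XX -> R) : R := fine (phi P h).

Lemma rphiE h : bdd h -> phi P h = (rphi h)%:E.
Proof. by move=> bh; rewrite /rphi fineK // phi_fin_num. Qed.

Lemma rphi_adherent h e : bdd h -> 0 < e ->
  exists m g, hedge h m g /\ (cost m g <= (rphi h + e)%:E)%E.
Proof.
move=> bh e0; have [r [m [g [Bg hg ->]]] /ltW rle] :=
  lb_ereal_inf_adherent e0 (phi_fin_num bh).
exists m, g; split=> //; apply: le_trans rle _.
by rewrite EFinD -rphiE.
Qed.

Lemma hedgeD h k m m' g g' : hedge h m g -> hedge k m' g' ->
  hedge (h \+ k) (m + m') (fun n => g n \+ g' n).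
Proof.
move=> [Bg hg] [Bg' hg']; split=> [n|x]; first exact: Bb_plusD.
have -> : oplus (fun n => g n \+ g' n) x = (oplus g x + oplus g' x)%E.
  rewrite /oplus -esumD.
  - by apply: eq_esum => n _; rewrite -EFinD.
  - by move=> n _; have [_ g0 _] := Bg n; rewrite lee_fin.
  - by move=> n _; have [_ g0 _] := Bg' n; rewrite lee_fin.
by rewrite !EFinD addeACA; exact: leeD.
Qed.

Lemma costD m m' g g' :
  (forall n, Bb_plus (g n)) -> (forall n, Bb_plus (g' n)) ->
  (cost (m + m')%R (fun n => g n \+ g' n)%R <= cost m g + cost m' g')%E.
Proof.
move=> Bg Bg'; rewrite /cost EFinD addeACA; apply: leeD => //.
rewrite -esumD.
- by apply: le_esum => n _; exact: phi_marginalD.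
- by move=> n _; have [_ g0 _] := Bg n; exact: phi_marginal_ge0.
- by move=> n _; have [_ g0 _] := Bg' n; exact: phi_marginal_ge0.
Qed.

Lemma rphi_sublinear : sublinear W (rphi : (XX -> R^o) -> R).
Proof.
split=> [h k bh bk|t h t0 bh].
  apply/ler_addgt0Pr => e e0; have e2 : 0 < e / 2 by rewrite divr_gt0.
  have [m [g [hg cg]]] := rphi_adherent bh e2.
  have [m' [g' [hg' cg']]] := rphi_adherent bk e2.
  have bhk : bdd (h \+ k) by exact: bddD.
  have : ((rphi (h \+ k))%:E <= (rphi h + e / 2 + (rphi k + e / 2))%:E)%E.
    rewrite -rphiE //; apply: le_trans (phi_le_cost (hedgeD hg hg')) _.
    apply: le_trans (costD _ _ hg.1 hg'.1) _.
    by rewrite EFinD; exact: leeD.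
  rewrite lee_fin => /le_trans; apply.
  by move: (rphi h) (rphi k) => a b; lra.
rewrite -ler_pdivrMl //; apply/ler_addgt0Pr => e e0.
have [m [g [[Bg hg] cg]]] := rphi_adherent bh e0.
have bth : bdd (fun x => t * h x) by exact: bddZ.
rewrite ler_pdivrMl // -lee_fin -[X in (X <= _)%E](rphiE bth).
have tg : hedge (fun x => t * h x) (t * m) (fun n x => t * g n x).
  split=> [n|x]; first by apply: Bb_plusZ => //; exact: ltW.
  rewrite /oplus; under eq_esum do rewrite EFinM.
  rewrite esumZl //; last by move=> n; have [_ g0 _] := Bg n; rewrite lee_fin.
  rewrite !EFinM -muleDr ?fin_num_adde_defr //.
  by apply: lee_wpmul2l; [rewrite lee_fin ltW|exact: hg].
apply: le_trans (phi_le_cost tg) _.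
apply: (@le_trans _ _ (t%:E * cost m g)%E); last first.
  by rewrite EFinM; apply: lee_wpmul2l; rewrite ?lee_fin // ltW.
rewrite /cost EFinM muleDr ?fin_num_adde_defr //; apply: leeD => //.
rewrite -esumZl //; last first.
  by move=> n; have [_ g0 _] := Bg n; exact: phi_marginal_ge0.
by apply: le_esum => n _; apply: phi_marginalZ => //; exact: ltW.
Qed.

Lemma rphi_le_sup h M : bdd h -> (forall x, h x <= M) -> rphi h <= M.
Proof. by move=> bh hM; rewrite -lee_fin -rphiE //; exact: phi_le_sup. Qed.

Lemma phi_cylinder n (g : X n -> R) : Bb_plus g ->
  (phi P (fun x => g (x n)) <= phim n g)%E.
Proof.
move=> Bg; have [_ g0 _] := Bg.
pose G := dfwith (fun k => fun _ : X k => 0 : R) n g.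
have Gn : G n = g by rewrite /G dfwithin.
have Gk k : k != n -> G k = fun=> 0.
  by move=> kn; rewrite /G dfwithout // eq_sym.
have hG : hedge (fun x => g (x n)) 0 G.
  split=> [k|x].
    by have [->|kn] := eqVneq k n; rewrite ?Gn ?Gk //; exact: Bb_plus0.
  rewrite add0e /oplus (esum_single (n := n)) ?Gn ?lee_fin //.
  by move=> k kn; rewrite Gk.
apply: le_trans (phi_le_cost hG) _; rewrite /cost add0e.
rewrite (esum_single (n := n)) ?Gn //; first exact: phi_marginal_ge0.
by move=> k kn; rewrite Gk // phi_marginal0.
Qed.

End CostFunctional.

(** * Couplings lie below the primal functional *)

Section WeakDuality.
Context {R : realType} {I : countType} {X : I -> ptopologicalType}.
Variable P : forall n, set (ca_plus R (X n)).
Arguments P : clear implicits.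
Notation XX := (prod_topology X).
Variable mu : probability (borel XX) R.
Hypothesis mu_coupling : couplings P mu.

Lemma coupling_integral_le n (g : X n -> R) : Bb_plus g ->
  (\int[mu]_(x in [set: borel XX]) (g (x n))%:E <= phi_marginal (P n) g)%E.
Proof.
move=> Bg; have [nu Pnu nuE] := mu_coupling n.
have [mg g0] := Bb_plus_EFin Bg.
apply: le_trans (phi_marginal_ub g Pnu); rewrite le_eqVlt; apply/orP; left.
pose pr (x : borel XX) : borel (X n) := x n.
pose gE (y : borel (X n)) : \bar R := (g y)%:E.
have mpr : measurable_fun setT pr by exact: pr_measurable.
have E1 : (\int[pushforward mu pr]_(y in [set: borel (X n)]) gE y =
    \int[mu]_(x in pr @^-1` setT) (gE \o pr) x)%E.
  by apply: ge0_integral_pushforward => // y _; exact: g0.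
rewrite preimage_setT in E1; apply/eqP; rewrite -[LHS]E1.
by apply: eq_measure_integral => A mA _; exact: nuE.
Qed.

Lemma coupling_integral_oplus (g : forall n, X n -> R) :
  (forall n, Bb_plus (g n)) ->
  measurable_fun [set: borel XX] (fun x : borel XX => oplus g x) /\
  (\int[mu]_(x in [set: borel XX]) oplus g x <=
    \esum_(n in [set: I]) phi_marginal (P n) (g n))%E.
Proof.
move=> Bg; have g0 n x : 0 <= g n x by have [_ + _] := Bg n; exact.
pose u (k : nat) (x : borel XX) : \bar R :=
  if @pickle_inv I k is Some n then (g n (x n))%:E else 0%E.
have u0 k x : (0 <= u k x)%E.
  by rewrite /u; case: pickle_inv => [n|] //; rewrite lee_fin.
have mu_ k : measurable_fun [set: borel XX] (u k).
  rewrite /u; case: pickle_inv => [n|]; last exact: measurable_cst.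
  apply/measurable_EFinP; have [_ _ mg] := Bg n.
  exact: (measurableT_comp mg (@pr_measurable I X n)).
have oE : (fun x : borel XX => oplus g x) = (fun x => \sum_(k <oo) u k x)%E.
  by apply/funext => x; rewrite /oplus esum_pickle // => k; rewrite lee_fin.
split; first by rewrite oE; apply: ge0_emeasurable_sum => // k x _ _; exact: u0.
under eq_integral => x _ do rewrite [oplus g x](congr1 (@^~ x) oE).
rewrite integral_nneseries //.
have phi0 n : (0 <= phi_marginal (P n) (g n))%E.
  have [nu Pnu _] := mu_coupling n; apply: le_trans (phi_marginal_ub (g n) Pnu).
  by apply: integral_ge0 => x _; rewrite lee_fin.
rewrite esum_pickle //; apply: lee_nneseries => k.
  by move=> _ _; exact: integral_ge0.
move=> _; rewrite /u; case: pickle_inv => [n|]; last by rewrite integral0.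
exact: coupling_integral_le.
Qed.

Lemma weak_duality f : bdd f ->
  measurable_fun [set: borel XX] (f : borel XX -> R) ->
  (\int[mu]_(x in [set: borel XX]) (f x)%:E <= phi P f)%E.
Proof.
move=> bf mf; apply: le_phi => m g [Bg fg].
have [mo io] := coupling_integral_oplus Bg.
have bfm : bdd (fun x => f x - m) by apply: (bddD bf (bdd_cst _ (- m))).
have mfm : measurable_fun [set: borel XX] (fun x : borel XX => f x - m).
  by apply: measurable_funB.
have ifm := bdd_integrable mu bfm mfm.
have im : mu.-integrable [set: borel XX] (EFin \o (cst m : borel XX -> R)).
  by apply: bdd_integrable => //; exact: bdd_cst.
have -> : (\int[mu]_(x in [set: borel XX]) (f x)%:E =
    m%:E + \int[mu]_(x in [set: borel XX]) (f x - m)%:E)%E.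
  have icst : (\int[mu]_(x in [set: borel XX]) m%:E = m%:E)%E.
    transitivity (m%:E * mu setT)%E.
      exact: (integral_cst mu measurableT m%:E).
    by rewrite probability_setT mule1.
  rewrite -[X in (X + _)%E]icst -(integralD measurableT im ifm).
  by apply: eq_integral => x _; rewrite /= -EFinD addrC subrK.
apply: leeD => //; apply: le_trans io.
(* [f - m] may be negative, unlike the sum above it: compare positive parts *)
rewrite integralE; apply: (@le_trans _ _
  (\int[mu]_(x in [set: borel XX]) (fun x : borel XX => (f x - m)%:E)^\+ x)%E).
  by rewrite -[leRHS]sube0; apply: leeB => //; exact: integral_ge0.
apply: ge0_le_integral => //.
  by apply: measurable_funepos; exact/measurable_EFinP.
move=> x _; rewrite funeposE ge_max EFinB leeBlDl // fg /=.
by apply: esum_ge0 => n _; have [_ g0 _] := Bg n; rewrite lee_fin.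
Qed.

End WeakDuality.

(** * Layers of an upper semicontinuous function *)

Section LayerSums.
Context {R : realType}.

(** [d] times the number of the first [J] positive multiples of [d] that are
    at most [h x]: for [h >= 0], the part of [h] up to [J * d], rounded down to
    a multiple of [d]. *)
Definition layers (T : Type) (d : R) (h : T -> R) (J : nat) (x : T) : R :=
  \sum_(j < J) d * \1_[set y | j.+1%:R * d <= h y] x.

Lemma layersS (T : Type) d (h : T -> R) J x : layers d h J.+1 x =
  layers d h J x + d * \1_[set y | J.+1%:R * d <= h y] x.
Proof. by rewrite /layers big_ord_recr. Qed.

Lemma layers_full (T : Type) d (h : T -> R) J x : 0 < d ->
  J%:R * d <= h x -> layers d h J x = J%:R * d.
Proof.
move=> d0; elim: J => [|J IH] hx; first by rewrite /layers big_ord0 mul0r.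
rewrite layersS indicE mem_set // mulr1 IH.
  by rewrite -natr1 mulrDl mul1r.
by apply: le_trans hx; rewrite ler_pM2r // ler_nat.
Qed.

Lemma layers_le (T : Type) d (h : T -> R) J x : 0 < d -> 0 <= h x ->
  layers d h J x <= h x.
Proof.
move=> d0 h0; elim: J => [|J IH]; first by rewrite /layers big_ord0.
have [hx|hx] := leP (J.+1%:R * d) (h x); first by rewrite layers_full.
rewrite layersS indicE memNset ?mulr0 ?addr0 //= => /(lt_le_trans hx).
by rewrite ltxx.
Qed.

Lemma le_layers (T : Type) d (h : T -> R) J x : 0 < d -> h x <= J%:R * d ->
  h x <= layers d h J x + d.
Proof.
move=> d0; elim: J => [|J IH] hx.
  by rewrite mul0r in hx; rewrite /layers big_ord0 add0r (le_trans hx) // ltW.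
have hS : layers d h J x <= layers d h J.+1 x.
  by rewrite layersS lerDl mulr_ge0 // ?ltW // indicE ler0n.
have [hJ|hJ] := leP (h x) (J%:R * d).
  by apply: le_trans (IH hJ) _; rewrite lerD2r.
apply: le_trans hx _; rewrite -natr1 mulrDl mul1r lerD2r; apply: le_trans hS.
by rewrite layers_full // ltW.
Qed.

End LayerSums.

(** * From a dominated linear functional to a coupling *)

Section StrongDuality.
Context {R : realType} {I : countType} {X : I -> ptopologicalType}.
Variable P : forall n, set (ca_plus R (X n)).
Arguments P : clear implicits.
Hypothesis X_polish : forall n, polish R (X n).
Hypothesis P_proba : forall n (nu : ca_plus R (X n)),
  P n nu -> nu [set: X n] = 1%E.
Hypothesis P_nonempty : forall n, P n !=set0.
Hypothesis P_convex : forall n, convex_measures (P n).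
Hypothesis P_compact : forall n, compact (P n).
Notation XX := (prod_topology X).
Notation W := (@bdd R XX : set (XX -> R^o)).
Variable L : (XX -> R^o) -> R.
Hypothesis L_linear : linear_on W L.
Hypothesis L_le : forall h, W h -> L h <= rphi P h.

Lemma functional_le_sup (h : XX -> R^o) M :
  bdd h -> (forall x, h x <= M) -> L h <= M.
Proof.
by move=> bh hM; apply: le_trans (L_le bh) _; exact: rphi_le_sup.
Qed.

Lemma functionalN (h : XX -> R^o) : bdd h -> L (fun x => - h x) = - L h.
Proof.
move=> bh; rewrite -[RHS]mulN1r -L_linear.2 // scaleN1r.
by congr L; apply/funext.
Qed.

Lemma functionalB (h k : XX -> R^o) : bdd h -> bdd k ->
  L (fun x => h x - k x) = L h - L k.
Proof.
move=> bh bk; rewrite -functionalN // -L_linear.1 //.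
exact: bddN.
Qed.

Lemma le_functional (h k : XX -> R^o) :
  bdd h -> bdd k -> (forall x, h x <= k x) -> L h <= L k.
Proof.
move=> bh bk hk; rewrite -subr_le0 -functionalB //; apply: functional_le_sup.
  exact: (bddD bh (bddN bk)).
by move=> x; rewrite subr_le0.
Qed.

Lemma functional_cst (c : R) : L (cst c) = c.
Proof.
apply/eqP; rewrite eq_le functional_le_sup //=; last exact: bdd_cst.
rewrite -lerN2 -functionalN; last exact: bdd_cst.
by apply: functional_le_sup => //; exact: (bdd_cst _ (- c)).
Qed.

Definition functional_charge (A : set XX) : R := L (\1_A : XX -> R).

Lemma bdd_indic (A : set XX) : bdd (\1_A : XX -> R).
Proof. by exists 1 => x; rewrite indicE normr_nat lern1 leq_b1. Qed.

Lemma functional_charge_ge0 A : 0 <= functional_charge A.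
Proof.
rewrite -(functional_cst 0); apply: le_functional => [||x].
- exact: bdd_cst.
- exact: bdd_indic.
- by rewrite indicE ler0n.
Qed.

Lemma functional_chargeU A B : A `&` B = set0 ->
  functional_charge (A `|` B) = functional_charge A + functional_charge B.
Proof.
move=> AB; rewrite /functional_charge -L_linear.1; try exact: bdd_indic.
congr L; apply/funext => x; rewrite /GRing.add /= !indicE in_setU.
case: (boolP (x \in A)) => xA; case: (boolP (x \in B)) => xB;
  rewrite ?addr0 ?add0r //=.
by have : (A `&` B) x by [split; exact: set_mem]; rewrite AB.
Qed.

Lemma functional_chargeT : functional_charge setT = 1.
Proof. by rewrite /functional_charge indicT; exact: functional_cst. Qed.

(** On functions of the [n]-th coordinate [L] is below the support function of
    [P n]: for nonnegative functions by hedging with that function alone, and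
    in general after adding a constant. *)
Lemma exists_marginals : exists nu : forall n, ca_plus R (X n),
  (forall n, P n (nu n)) /\
  forall n (g : X n -> R), Cb g ->
    L (fun x => g (x n)) = \int[nu n]_(x in [set: borel (X n)]) g x.
Proof.
have h n : exists nu : ca_plus R (X n), P n nu /\
    forall g : X n -> R, Cb g ->
      L (fun x => g (x n)) = \int[nu]_(x in [set: borel (X n)]) g x.
  pose Ln (g : X n -> R) := L (fun x => g (x n)).
  have bpr (g : X n -> R) : Cb g -> bdd (fun x : XX => g (x n)).
    by move=> [/bounded_funP[M gM] _]; exists M => x; exact: gM.
  have Ln_linear : linear_on (@Cb R (X n) : set (X n -> R^o)) Ln.
    split=> [u v Cu Cv|t u Cu].
      by apply: L_linear.1; exact: bpr.
    by apply: L_linear.2; exact: bpr.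
  have Ln_le (g : X n -> R) : Cb g -> ((Ln g)%:E <= ereal_sup
      [set (\int[nu]_(x in [set: borel (X n)]) g x)%:E | nu in P n])%E.
    move=> Cg; have [/bounded_funP[M gM] _] := Cg.
    have CM : Cb (cst M : X n -> R) by exact: Cb_cst.
    have CgM : Cb (g \+ cst M) by exact: CbD.
    have BgM : Bb_plus (g \+ cst M).
      split; [by case: CgM| |exact: Cb_measurable].
      by move=> x /=; have := gM x; rewrite ler_norml => /andP[+ _]; lra.
    have LgM : ((Ln g + M)%:E <= phi_marginal (P n) (g \+ cst M)%R)%E.
      apply: le_trans (phi_cylinder P_nonempty BgM).
      rewrite (rphiE P_proba P_nonempty) ?lee_fin; last exact: (bpr _ CgM).
      apply: le_trans (L_le (bpr _ CgM)).
      rewrite (Ln_linear.1 g (cst M) Cg CM :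
        L (fun x => (g \+ cst M) (x n)) = _).
      by rewrite (functional_cst M : Ln (cst M) = M).
    rewrite -[X in (X <= _)%E](_ : (Ln g + M)%:E - M%:E = (Ln g)%:E)%E;
      last first.
      by rewrite -EFinB addrK.
    rewrite leeBlDr //; apply: le_trans LgM _.
    apply: ge_ereal_sup => _ [nu Pnu <-].
    have -> : (\int[nu]_(x in [set: borel (X n)]) ((g \+ cst M)%R x)%:E =
        (\int[nu]_(x in [set: borel (X n)]) g x)%:E + M%:E)%E.
      have := (Rintegral_linear nu).1 _ _ Cg CM.
      rewrite (Rintegral_cst_proba (@P_proba n) M Pnu) -EFinD => <-.
      rewrite /Rintegral fineK //.
      exact: (integrable_fin_num measurableT (Cb_integrable nu CgM)).
    by apply: leeD => //; apply: ereal_sup_ubound; exists nu.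
  have [nu Pnu nuL] := exists_marginal (@P_proba n) (P_nonempty n)
    (P_convex (n := n)) (P_compact (n := n)) Ln_linear Ln_le.
  by exists nu.
exists (fun n => sval (cid (h n))); split=> n.
  exact: (svalP (cid (h n))).1.
exact: (svalP (cid (h n))).2.
Qed.

(** [L] and [nu n] are only known to agree on continuous functions; the
    indicator of [F] is below the continuous [h], which is below the indicator
    of [u < a]. *)
Lemma functional_charge_marginal_le (nu : forall n, ca_plus R (X n)) n
    (F : set (X n)) :
  (forall g : X n -> R, Cb g ->
     L (fun x => g (x n)) = \int[nu n]_(x in [set: borel (X n)]) g x) ->
  closed F ->
  ((functional_charge ((fun x : XX => x n) @^-1` F))%:E <= nu n F)%E.
Proof.
move=> nuL cF; have [u [cu u01 FE]] := zero_set_closed (X_polish n) cF.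
rewrite [X in nu n X]FE -[X in nu n X]setTI; apply: measure_inf_level => //.
  by move=> a; apply: open_borel; exact: open_lt.
move=> a a0; rewrite setTI.
pose h (y : X n) : R := Num.max 0 (1 - a^-1 * u y).
have ai : 0 < a^-1 by rewrite invr_gt0.
have h1 y : h y <= 1.
  rewrite ge_max ler01 /= gerBl; apply: mulr_ge0; first exact: ltW.
  by have /andP[] := u01 y.
have h0 y : 0 <= h y by rewrite le_max lexx.
have Ch : Cb h.
  split; first by apply/bounded_funP; exists 1 => y; rewrite ger0_norm.
  move=> y; apply: (@continuous_max _ _ (cst 0) (fun y => 1 - a^-1 * u y)).
    exact: cst_continuous.
  by apply: cvgB; [exact: cvg_cst|apply: cvgM; [exact: cvg_cst|exact: cu]].
have mA : measurable ([set y | u y < a] : set (borel (X n))).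
  by apply: open_borel; exact: open_lt.
apply: (@le_trans _ _ (L (fun x => h (x n)))%:E).
  rewrite lee_fin; apply: le_functional; first exact: bdd_indic.
    by exists 1 => x; rewrite ger0_norm.
  move=> x; rewrite indicE; case: (boolP (_ \in _)) => // /set_mem.
  rewrite /= {1}FE /= => ux; rewrite le_max; apply/orP; right.
  have -> : u (x n) = 0.
    by apply/eqP; rewrite eq_le ux; have /andP[] := u01 (x n).
  by rewrite mulr0 subr0.
rewrite nuL // /Rintegral fineK; last first.
  exact: (integrable_fin_num measurableT (Cb_integrable (nu n) Ch)).
rewrite -[X in nu n X]setIT -(integral_indic (nu n) measurableT mA).
apply: ge0_le_integral => //.
- by move=> y _; rewrite lee_fin.
- by apply/measurable_EFinP; exact: Cb_measurable.
- by apply/measurable_EFinP; exact: measurable_indic.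
- move=> y _; rewrite lee_fin indicE.
  case: (boolP (y \in _)) => [_|]; first exact: h1.
  rewrite notin_setE /= => /negP; rewrite -leNgt => ua.
  by rewrite ge_max lexx /= subr_le0 mulrC ler_pdivlMr ?mul1r.
Qed.

(** The superlevel sets of [f] are closed, and on closed sets [mu] dominates the
    set function of [L]; summing over finitely many layers of thickness [d]
    compares [L f] with the integral up to an error [d]. *)
Lemma functional_le_integral (mu : probability (borel XX) R) (f : XX -> R) :
  (forall F : set XX, closed F -> ((functional_charge F)%:E <= mu F)%E) ->
  Ub f -> L f <= \int[mu]_(x in [set: borel XX]) f x.
Proof.
move=> Lmu [/bounded_funP bf uf]; have [M fM] := bf.
have imu (h : XX -> R) : bdd h ->
    measurable_fun [set: borel XX] (h : borel XX -> R) ->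
    mu.-integrable [set: borel XX] (EFin \o (h : borel XX -> R)).
  exact: bdd_integrable.
(* the layers of a function start at level zero *)
pose h x := f x + M.
have h0 x : 0 <= h x.
  by have := fM x; rewrite /h ler_norml => /andP[+ _]; lra.
have hM x : h x <= 2 * M.
  by have := fM x; rewrite /h ler_norml => /andP[_]; lra.
have mf := usc_measurable uf.
have bh : bdd h by apply: (bddD bf (bdd_cst _ M)).
have mh : measurable_fun [set: borel XX] (h : borel XX -> R).
  by apply: measurable_funD.
pose S d J := layers d h J.
pose A (d : R) (J : nat) : set XX := [set y | J.+1%:R * d <= h y].
have cA d J : closed (A d J).
  rewrite -openC openE => x /= /negP; rewrite -ltNge => hx.
  have fx : f x < J.+1%:R * d - M by rewrite ltrBrDr.
  apply: filterS (uf x _ fx) => y; rewrite ltrBrDr => hy /(lt_le_trans hy).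
  by rewrite ltxx.
have S0 d : S d 0%N = cst 0.
  by apply/funext => x; rewrite /S /layers big_ord0.
have SS d J : S d J.+1 = (S d J \+ (fun x => d * \1_(A d J) x)).
  by apply/funext => x; exact: layersS.
have bS d J : bdd (S d J).
  elim: J => [|J IH]; first by rewrite S0; exact: bdd_cst.
  by rewrite SS; apply: bddD => //; apply: bddZ; exact: bdd_indic.
have m1 d J : measurable_fun [set: borel XX] (\1_(A d J) : borel XX -> R).
  by apply: measurable_indic; exact: closed_borel.
have mS d J : measurable_fun [set: borel XX] (S d J : borel XX -> R).
  elim: J => [|J IH]; first by rewrite S0; exact: measurable_cst.
  by rewrite SS; apply: measurable_funD => //; exact: measurable_funM.
have LS d J : 0 < d -> L (S d J) <= \int[mu]_(x in [set: borel XX]) S d J x.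
  move=> d0; elim: J => [|J IH].
    by rewrite S0 functional_cst Rintegral_cst // mul0r.
  have b1 := bdd_indic (A d J).
  rewrite SS (L_linear.1 (S d J) (fun x => d * \1_(A d J) x)) //; last first.
    exact: bddZ.
  rewrite RintegralD //; [|exact: imu|]; last first.
    by apply: imu; [exact: bddZ|exact: measurable_funM].
  apply: lerD => //; rewrite (L_linear.2 d (\1_(A d J))) //.
  rewrite RintegralZl //; last exact: imu.
  rewrite ler_pM2l // -lee_fin /Rintegral fineK; last first.
    exact: (integrable_fin_num measurableT (imu _ b1 (m1 d J))).
  rewrite integral_indic ?setIT //; last exact: closed_borel.
  exact: Lmu.
have Lh : L h = L f + M.
  by rewrite (L_linear.1 f (cst M)) ?functional_cst //; exact: bdd_cst.
have Ih : \int[mu]_(x in [set: borel XX]) h x =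
    \int[mu]_(x in [set: borel XX]) f x + M.
  rewrite RintegralD //; [|exact: imu|]; last first.
    by apply: imu => //; exact: bdd_cst.
  congr (_ + _); transitivity (M * fine (mu setT)).
    exact: (Rintegral_cst _ measurableT).
  by rewrite probability_setT mulr1.
rewrite -(lerD2r M) -Lh -Ih; apply/ler_addgt0Pr => d d0.
pose J := Num.bound `|2 * M / d|.
have MJ : 2 * M <= J%:R * d.
  rewrite -ler_pdivrMr //; apply/ltW; apply: le_lt_trans (ler_norm _) _.
  exact: archi_boundP.
apply: (@le_trans _ _ (L (S d J) + d)).
  rewrite -[X in _ + X](functional_cst d) -L_linear.1 //; last exact: bdd_cst.
  apply: le_functional => //; first by apply: bddD => //; exact: bdd_cst.
  by move=> x; apply: le_layers => //; exact: le_trans (hM x) MJ.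
rewrite lerD2r; apply: le_trans (LS d J d0) _.
apply: le_Rintegral => //; [exact: imu|exact: imu|].
by move=> x _; apply: layers_le.
Qed.

Lemma exists_coupling_above_functional (f : XX -> R) : Ub f ->
  exists2 mu : probability (borel XX) R, couplings P mu &
    L f <= \int[mu]_(x in [set: borel XX]) f x.
Proof.
move=> Uf; have [nu [Pnu nuL]] := exists_marginals.
have nuT n : nu n [set: borel (X n)] = 1%E by exact: (P_proba (Pnu n)).
have [mu [muE muF]] := exists_probability_above_charge X_polish
  functional_charge_ge0 functional_chargeU functional_chargeT
  (fun n F => @functional_charge_marginal_le nu n F (nuL n)) nuT.
exists mu; last exact: functional_le_integral.
by move=> n; exists (nu n) => // A mA; exact: muE.
Qed.

End StrongDuality.

(** * The duality theorem *)

Lemma strong_duality (R : realType) (I : countType) (X : I -> ptopologicalType)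
    (P : forall n, set (ca_plus R (X n)))
    (X_polish : forall n, polish R (X n))
    (P_proba : forall n (nu : ca_plus R (X n)), P n nu -> nu [set: X n] = 1%E)
    (P_nonempty : forall n, P n !=set0)
    (P_convex : forall n, convex_measures (P n))
    (P_compact : forall n, compact (P n))
    (f : prod_topology X -> R) : Ub f ->
  exists2 mu : probability (borel (prod_topology X)) R, couplings P mu &
    (phi P f <= \int[mu]_(x in [set: borel (prod_topology X)]) (f x)%:E)%E.
Proof.
move=> Uf; have [/bounded_funP bf uf] := Uf.
have [L [L_linear L_le Lf]] := @hahn_banach R (prod_topology X -> R^o)
  (@bdd R (prod_topology X)) (bdd_cst _ 0) (fun g h => @bddD R _ g h)
  (fun t g => @bddZ R _ t g) (rphi P) f (rphi_sublinear P_proba P_nonempty) bf.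
have [mu Pmu fmu] := exists_coupling_above_functional X_polish P_proba
  P_nonempty P_convex P_compact L_linear L_le Uf.
exists mu => //; rewrite (rphiE P_proba P_nonempty bf) -Lf.
have if_ := bdd_integrable mu bf (usc_measurable uf).
apply: (@le_trans _ _ (\int[mu]_(x in [set: borel (prod_topology X)]) f x)%:E).
  by rewrite lee_fin.
by rewrite /Rintegral fineK //; exact: (integrable_fin_num measurableT if_).
Qed.

Unset Implicit Arguments.

Theorem corollary4p4 (R : realType) (I : countType) (X : I -> ptopologicalType)
    (P : forall n, set (ca_plus R (X n)))
    (X_polish : forall n, polish R (X n))
    (P_proba : forall n (nu : ca_plus R (X n)), P n nu -> nu [set: X n] = 1%E)
    (P_nonempty : forall n, P n !=set0)
    (P_convex : forall n, convex_measures (P n))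
    (P_compact : forall n, compact (P n))
    (f : prod_topology X -> R) (f_Ub : @Ub R (prod_topology X) f) :
  (exists2 mu : probability (borel (prod_topology X)) R,
     couplings P mu &
     phi P f = (\int[mu]_(x in [set: borel (prod_topology X)]) (f x)%:E)%E) /\
  (forall mu : probability (borel (prod_topology X)) R, couplings P mu ->
     (\int[mu]_(x in [set: borel (prod_topology X)]) (f x)%:E <= phi P f)%E).
Proof.
have [/bounded_funP bf uf] := f_Ub.
have weak (mu : probability (borel (prod_topology X)) R) : couplings P mu ->
    (\int[mu]_(x in [set: borel (prod_topology X)]) (f x)%:E <= phi P f)%E.
  by move=> Pmu; exact: (weak_duality Pmu bf (usc_measurable uf)).
split=> //.
have [mu Pmu fmu] := strong_duality X_polish P_proba P_nonempty P_convex
  P_compact f_Ub.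
by exists mu => //; apply/eqP; rewrite eq_le fmu weak.
Qed.
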